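(* Let $f\in L^2(\mathbb C)$, and for $L>0$ let $\Xi_L$ be the infinite Ginibre point process on $\mathbb C$ with intensity $L/\pi$. Then $$\lim_{L\to\infty}\operatorname{Var}\Big(\sum_{x\in\Xi_L}f(x)\Big)=\frac1{4\pi}\int_{\mathbb C}|\nabla f(z)|^2\,dz.$$ In particular, the limit is finite if and only if $f\in H^1(\mathbb C)$.
   Context: Functions are real-valued and $dz$ is Lebesgue measure on $\mathbb C\cong\mathbb R^2$. $H^1(\mathbb C)$ is the space of $f\in L^2(\mathbb C)$ with weak gradient in $L^2$; $\int|\nabla f|^2$ is understood as $+\infty$ if $f\notin H^1(\mathbb C)$. Determinantal point process (DPP): a simple point process whose joint intensities with respect to a background measure $\mu$ are $\det(K(x_i,x_j))_{i,j=1}^\ell$, $\ell\ge1$, for a kernel $K$. Infinite Ginibre process of intensity $L/\pi$: the DPP on $\mathbb C$, of projection type, with Lebesgue background measure and kernel $$K(z,w)=\frac L\pi e^{Lz\bar w-\frac L2(|z|^2+|w|^2)},\qquad |K(z,w)|=\frac L\pi e^{-\frac L2|z-w|^2}.$$ For a projection-type DPP the variance of a linear statistic is given by $\operatorname{Var}\big(\sum_{x\in\Xi}f(x)\big)=\frac12\iint|f(x)-f(y)|^2|K(x,y)|^2\,d\mu(x)d\mu(y)$; for general $f\in L^2$ the variance is understood through this formula. *)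

(* Defs.v *)
From mathcomp Require Import all_boot all_order all_algebra.
From mathcomp Require Import all_classical all_reals all_analysis.
From mathcomp Require Import complex.

Set Implicit Arguments.
Unset Strict Implicit.
Unset Printing Implicit Defensive.

Import Order.TTheory GRing.Theory Num.Theory.
Import numFieldNormedType.Exports.

Local Open Scope classical_set_scope.
Local Open Scope ring_scope.
Local Open Scope complex_scope.

(* The complex plane is handled as [R * R], which carries both the Borel
   sigma-algebra and the normed structure; [R[i]] only carries the algebra. *)
Definition toC (R : realType) (z : R * R) : R[i] := z.1 +i* z.2.

Definition expC (R : realType) (z : R[i]) : R[i] :=
  (expR (complex.Re z))%:C * (cos (complex.Im z) +i* sin (complex.Im z)).

Definition cabs (R : realType) (z : R[i]) : R := ComplexField.Normc.normc z.

Definition lebesgue2 (R : realType) :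
    {measure set (measurableTypeR R * measurableTypeR R) -> \bar R} :=
  (@lebesgue_measure R \x @lebesgue_measure R)%E.

Definition L2 (R : realType) : set (R * R -> R) :=
  [set f | f \in Lfun (lebesgue2 R) 2%:E].

(* Variance of the linear statistic of [f] under the projection-type
   determinantal point process with kernel [K] and background measure [mu].
   For a general square-integrable [f] the sum over the points of the process
   need not converge, and this formula is the definition of the variance. *)
Definition dpp_variance d (T : measurableType d) (R : realType)
    (mu : {measure set T -> \bar R}) (K : T -> T -> R[i]) (f : T -> R) :
    \bar R :=
  ((2^-1)%:E *
   \int[mu]_x \int[mu]_y (`|f x - f y| ^+ 2 * cabs (K x y) ^+ 2)%:E)%E.

Definition ginibre_kernel (R : realType) (L : R) (z w : R * R) : R[i] :=
  (L / pi)%:C *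
  expC (L%:C * toC z * conjc (toC w)
        - (L / 2 * (cabs (toC z) ^+ 2 + cabs (toC w) ^+ 2))%:C).

Definition ginibre_variance (R : realType) (L : R) (f : R * R -> R) : \bar R :=
  dpp_variance (lebesgue2 R) (ginibre_kernel L) f.

Definition e1 (R : realType) : R * R := (1, 0).
Definition e2 (R : realType) : R * R := (0, 1).

Fixpoint is_Ck (R : realType) (k : nat) (phi : R * R -> R) : Prop :=
  if k is k'.+1 then
    [/\ forall z, derivable phi z (e1 R) /\ derivable phi z (e2 R),
        is_Ck k' (fun z => 'D_(e1 R) phi z) &
        is_Ck k' (fun z => 'D_(e2 R) phi z)]
  else continuous phi.

Definition test_function (R : realType) (phi : R * R -> R) : Prop :=
  (forall k, is_Ck k phi) /\ compact (closure [set z | phi z != 0]).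

Definition is_weak_partial (R : realType) (v : R * R) (f g : R * R -> R) :
    Prop :=
  forall phi : R * R -> R, test_function phi ->
    \int[lebesgue2 R]_z (f z * 'D_v phi z) =
    - \int[lebesgue2 R]_z (g z * phi z).

Definition is_L2_weak_gradient (R : realType) (f : R * R -> R)
    (g : (R * R -> R) * (R * R -> R)) : Prop :=
  [/\ L2 g.1, L2 g.2, is_weak_partial (e1 R) f g.1 &
      is_weak_partial (e2 R) f g.2].

Definition H1 (R : realType) : set (R * R -> R) :=
  [set f | L2 f /\ exists g, is_L2_weak_gradient f g].

(* A representative: the weak gradient is unique up to a null set. *)
Definition weak_gradient (R : realType) (f : R * R -> R) :
    (R * R -> R) * (R * R -> R) :=
  xget (cst 0, cst 0) [set g | is_L2_weak_gradient f g].

Definition dirichlet (R : realType) (f : R * R -> R) : \bar R :=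
  if `[< H1 f >] then
    (\int[lebesgue2 R]_z
       ((weak_gradient f).1 z ^+ 2 + (weak_gradient f).2 z ^+ 2)%:E)%E
  else +oo%E.

(* Main.v *)
Require Import Defs.
From HB Require Import structures.
From mathcomp Require Import all_boot all_order all_algebra.
From mathcomp Require Import all_classical all_reals all_analysis.
From mathcomp Require Import measurable_realfun ring lra.
From mathcomp Require complex.
Import Order.TTheory GRing.Theory Num.Theory.
Import numFieldNormedType.Exports.
Local Open Scope classical_set_scope.
Local Open Scope ring_scope.

(** Since the modulus of the Ginibre kernel is a Gaussian in [z - w], Tonelli's
    theorem and a translation turn the variance into an average of increments,
      [(L / pi) ^+ 2 / 2 * \int exp (- L |h|^2) incr f h dh],
    where [incr f h] is the square norm of [f (z + h) - f z].  For small [h] the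
    increment is close to the quadratic form given by the square norm of
    [h.1 * g1 + h.2 * g2], where [(g1, g2)] is the gradient of [f].  As [L]
    grows, the Gaussian concentrates at the origin; it is even in each
    coordinate, so that the average of a quadratic form is its trace times
    [pi / (2 * L ^+ 2)], and the factors combine to [1 / (4 * pi)].

    This becomes a proof by two one-sided bounds.
    - Upper bound: if [f] has a weak gradient, the increment is at most the
      quadratic form for every [h] ([incr_le_gradient]), so the variance never
      exceeds the limit ([ginibre_variance_le]).
    - Lower bound: for every square-integrable [f], pairing the increment with
      [h.1 * p1 + h.2 * p2] for test functions [p1], [p2] bounds it from below
      by a quadratic form up to a cubic error ([incr_ge]).  The error
      disappears in the average, and what is left is the functional
        [- 2 * <f, div p> - |p1|^2 - |p2|^2]
      evaluated at the field [p = (p1, p2)] ([ginibre_variance_ge]).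

    By duality, the supremum of this functional over all test fields is the
    Dirichlet integral of [f].  When the supremum is finite, maximizing
    sequences converge and their limit is the weak gradient ([riesz_subspace],
    [H1_of_functional_bound]); so outside [H1] the functional is unbounded and
    the variance tends to infinity.  Inside [H1] the supremum is the Dirichlet
    integral because test functions are dense ([nrm2_le_test]), which rests on
    the fundamental lemma of the calculus of variations
    ([orthogonal_test_eq0]).

    Norms are handled through the inequality [2 <f, g> - |g|^2 <= |f|^2], an
    equality for [g = f]: it is affine in [f], so that bounds pass through
    pairings with smooth functions and density gives back the norm. *)

(** * Square-integrable functions *)

Section L2definitions.
Context {d} {T : measurableType d} {R : realType}.
Context (mu : {measure set T -> \bar R}).
Implicit Types f g : T -> R.

Definition sqint f :=
  measurable_fun setT f /\ (\int[mu]_x (f x ^+ 2)%:E < +oo)%E.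

Definition inner f g : R := \int[mu]_x (f x * g x).

Definition nrm2 f : R := inner f f.

End L2definitions.

Section L2space.
Context {d} {T : measurableType d} {R : realType}
  {mu : {measure set T -> \bar R}}.
Implicit Types f g h : T -> R.
Local Notation sqint := (sqint mu).
Local Notation inner := (inner mu).
Local Notation nrm2 := (nrm2 mu).

Lemma sqintP f : f \in Lfun mu 2%:E <-> sqint f.
Proof.
split=> [Lf|[mf fint]].
  split; first by move: Lf; rewrite inE => /andP[/[!inE]].
  have /integrableP[_] := Lfun2_integrable_sqr Lf.
  by under eq_integral => x _ do rewrite /= ger0_norm ?sqr_ge0//.
rewrite inE; apply/andP; split; rewrite inE//= /finite_norm unlock.
apply: poweR_lty; apply: le_lt_trans fint.
rewrite le_eqVlt; apply/orP; left; apply/eqP; apply: eq_integral => x _.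
by rewrite /= powR_mulrn// real_normK ?num_real.
Qed.

Lemma sqint_sqr f : sqint f -> mu.-integrable setT (fun x => (f x ^+ 2)%:E).
Proof. by move=> /sqintP /Lfun2_integrable_sqr. Qed.

Lemma integrable_mul f g : sqint f -> sqint g ->
  mu.-integrable setT (fun x => (f x * g x)%:E).
Proof.
move=> /sqintP Lf /sqintP Lg.
by have /Lfun1_integrable := Lfun2_mul_Lfun1 Lf Lg.
Qed.

Lemma sqint_le f g h : measurable_fun setT h ->
  sqint f -> sqint g -> (forall x, h x ^+ 2 <= f x ^+ 2 + g x ^+ 2) -> sqint h.
Proof.
move=> mh sf sg hfg; split => //.
have /integrableP[_] := integrableD measurableT (sqint_sqr f sf)
  (sqint_sqr g sg).
apply: le_lt_trans; apply: ge0_le_integral => //=.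
- by move=> x _; rewrite lee_fin sqr_ge0.
- by apply/measurable_EFinP; exact: measurable_funX.
- apply/measurable_EFinP; apply: measurableT_comp => //.
  by apply: measurable_funD; apply: measurable_funX; [case: sf|case: sg].
- by move=> x _; rewrite lee_fin (le_trans (hfg x))// ler_norm.
Qed.

Lemma sqintZ (a : R) f : sqint f -> sqint (fun x => a * f x).
Proof.
move=> [mf fint]; split; first exact: measurable_funM.
under eq_integral => x _ do rewrite exprMn EFinM.
rewrite ge0_integralZl//.
- by rewrite lte_mul_pinfty// lee_fin sqr_ge0.
- by apply/measurable_EFinP; exact: measurable_funX.
- by move=> x _; rewrite lee_fin sqr_ge0.
- by rewrite lee_fin sqr_ge0.
Qed.

Lemma sqintD f g : sqint f -> sqint g -> sqint (fun x => f x + g x).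
Proof.
move=> sf sg; apply: (@sqint_le (fun x => 2 * f x) (fun x => 2 * g x)).
- by apply: measurable_funD; [case: sf|case: sg].
- exact: sqintZ.
- exact: sqintZ.
- by move=> x; have := sqr_ge0 (f x - g x); have := sqr_ge0 (f x + g x); nra.
Qed.

Lemma sqintN f : sqint f -> sqint (fun x => - f x).
Proof.
by move=> /(sqintZ (-1)); congr sqint; apply/funext => x; rewrite mulN1r.
Qed.

Lemma sqintB f g : sqint f -> sqint g -> sqint (fun x => f x - g x).
Proof. by move=> sf sg; apply: sqintD => //; exact: sqintN. Qed.

Lemma innerC f g : inner f g = inner g f.
Proof. by rewrite /inner; under eq_Rintegral do rewrite mulrC. Qed.

Lemma innerDl f g h : sqint f -> sqint g -> sqint h ->
  inner (fun x => f x + g x) h = inner f h + inner g h.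
Proof.
move=> sf sg sh; rewrite /inner -RintegralD//; try exact: integrable_mul.
by apply: eq_Rintegral => x _; rewrite mulrDl.
Qed.

Lemma innerZl (a : R) f h : sqint f -> sqint h ->
  inner (fun x => a * f x) h = a * inner f h.
Proof.
move=> sf sh; rewrite /inner -RintegralZl//; try exact: integrable_mul.
by apply: eq_Rintegral => x _; rewrite mulrA.
Qed.

Lemma innerNl f h : sqint f -> sqint h ->
  inner (fun x => - f x) h = - inner f h.
Proof.
move=> sf sh; rewrite -mulN1r -innerZl//.
by congr inner; apply/funext => x; rewrite mulN1r.
Qed.

Lemma innerBl f g h : sqint f -> sqint g -> sqint h ->
  inner (fun x => f x - g x) h = inner f h - inner g h.
Proof. by move=> sf sg sh; rewrite innerDl ?innerNl//; exact: sqintN. Qed.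

Lemma innerDr f g h : sqint f -> sqint g -> sqint h ->
  inner h (fun x => f x + g x) = inner h f + inner h g.
Proof. by move=> *; rewrite innerC innerDl// !(innerC h). Qed.

Lemma innerZr (a : R) f h : sqint f -> sqint h ->
  inner h (fun x => a * f x) = a * inner h f.
Proof. by move=> *; rewrite innerC innerZl// !(innerC h). Qed.

Lemma innerBr f g h : sqint f -> sqint g -> sqint h ->
  inner h (fun x => f x - g x) = inner h f - inner h g.
Proof. by move=> *; rewrite innerC innerBl// !(innerC h). Qed.

Lemma nrm2_ge0 f : 0 <= nrm2 f.
Proof. by apply: Rintegral_ge0 => x _; rewrite -expr2 sqr_ge0. Qed.

Lemma nrm2E f : sqint f -> (nrm2 f)%:E = (\int[mu]_x (f x ^+ 2)%:E)%E.
Proof.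
move=> sf; rewrite /nrm2 /inner /Rintegral fineK//.
exact: (integrable_fin_num measurableT (integrable_mul f f sf sf)).
Qed.

Lemma nrm2Z (a : R) f : sqint f -> nrm2 (fun x => a * f x) = a ^+ 2 * nrm2 f.
Proof.
move=> sf; rewrite /nrm2 innerZl ?innerZr// ?mulrA ?expr2//; exact: sqintZ.
Qed.

Lemma nrm2D f g : sqint f -> sqint g ->
  nrm2 (fun x => f x + g x) = nrm2 f + 2 * inner f g + nrm2 g.
Proof.
move=> sf sg; rewrite /nrm2 innerDl ?innerDr//; try exact: sqintD.
by rewrite (innerC g f); ring.
Qed.

Lemma nrm2B f g : sqint f -> sqint g ->
  nrm2 (fun x => f x - g x) = nrm2 f - 2 * inner f g + nrm2 g.
Proof.
move=> sf sg; rewrite /nrm2 innerBl ?innerBr//; try exact: sqintB.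
by rewrite (innerC g f); ring.
Qed.

Lemma nrm2_lin (a b : R) f g : sqint f -> sqint g ->
  nrm2 (fun x => a * f x + b * g x) =
  a ^+ 2 * nrm2 f + 2 * a * b * inner f g + b ^+ 2 * nrm2 g.
Proof.
move=> sf sg; have saf := sqintZ a _ sf; have sbg := sqintZ b _ sg.
by rewrite nrm2D// !nrm2Z// innerZl// innerZr//; ring.
Qed.

(** The variational form of the Cauchy-Schwarz inequality. *)
Lemma inner_le f g : sqint f -> sqint g -> 2 * inner f g - nrm2 g <= nrm2 f.
Proof.
by move=> sf sg; have := nrm2_ge0 (fun x => f x - g x); rewrite nrm2B//; lra.
Qed.

Lemma limn_einf_le (v : nat -> \bar R) N (c : \bar R) :
  (forall n, (N <= n)%N -> (v n <= c)%E) -> (limn_einf v <= c)%E.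
Proof.
move=> vc; rewrite limn_einf_lim; apply: lime_le; first exact: is_cvg_einfs.
apply: nearW => n; apply: le_trans (vc (maxn n N) (leq_maxr _ _)).
by apply: ereal_inf_lbound; exists (maxn n N) => //=; exact: leq_maxl.
Qed.

(** Differences that are summable against growing weights converge almost
    everywhere, and Fatou's lemma identifies the pointwise limit with the
    limit in mean square. *)
Lemma riesz_fischer (u : nat -> T -> R) :
  (forall n, sqint (u n)) ->
  (forall n m, (n <= m)%N -> nrm2 (fun x => u n x - u m x) <= 8^-1 ^+ n) ->
  exists g, sqint g /\ forall n, nrm2 (fun x => u n x - g x) <= 8^-1 ^+ n.
Proof.
move=> su uC.
(* The square norms decay like [8 ^- n]: the weight [4 ^+ n] keeps the sum of
   the integrals finite and makes the pointwise differences geometric. *)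
pose D n x := (4 ^+ n * (u n.+1 x - u n x) ^+ 2)%:E : \bar R.
have sD n : sqint (fun x => u n.+1 x - u n x) by exact: sqintB.
have D0 n x : setT x -> (0 <= D n x)%E.
  by move=> _; rewrite lee_fin mulr_ge0 ?sqr_ge0 ?exprn_ge0.
have mD n : measurable_fun setT (D n).
  apply/measurable_EFinP; apply: measurable_funM => //.
  by apply: measurable_funX; case: (sD n).
have intD : mu.-integrable setT (fun x => \sum_(0 <= n <oo) D n x)%E.
  apply/integrableP; split; first by
    apply: (@ge0_emeasurable_sum _ _ _ _ D xpredT) => // k x _ _; exact: D0.
  under eq_integral => x _ do
    (rewrite gee0_abs; last by apply: nneseries_ge0 => n _ _; exact: D0).
  rewrite integral_nneseries//.
  apply: (@le_lt_trans _ _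
      (\sum_(0 <= n <oo) ((2 : R) / (2 ^ (n + 1))%:R)%:E)%E); last first.
    rewrite (cvg_lim _ (@cvg_geometric_eseries_half R 2 0)) ?ltry//.
  apply: lee_nneseries => [n _ _|n _]; first by apply: integral_ge0 => x _;
    exact: D0.
  rewrite /D; under eq_integral => x _ do rewrite EFinM.
  rewrite ge0_integralZl//; first last.
  - by move=> x _; rewrite lee_fin sqr_ge0.
  - by apply/measurable_EFinP; apply: measurable_funX; case: (sD n).
  rewrite -nrm2E// -EFinM lee_fin.
  have -> : 2 / (2 ^ (n + 1))%:R = 4 ^+ n * 8^-1 ^+ n :> R.
    rewrite -exprMn (_ : 4 * 8^-1 = 2^-1 :> R); last by lra.
    by rewrite addn1 expnS natrM invfM mulrA divff// mul1r natrX exprVn.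
  rewrite ler_pM2l ?exprn_gt0//.
  rewrite (_ : (fun x => _) = (fun x => -1 * (u n x - u n.+1 x))); last first.
    by apply/funext => x; ring.
  by rewrite nrm2Z ?sqrrN ?expr1n ?mul1r ?uC//; exact: sqintB.
(* The upper limit is defined everywhere and measurable, and agrees with the
   limit wherever there is one. *)
pose g x := fine (limn_esup (fun n => (u n x)%:E)).
have mg : measurable_fun setT g.
  apply: measurableT_comp => //; apply: measurable_fun_limn_esup => n.
  by apply/measurable_EFinP; case: (su n).
have ug : \forall x \ae mu, u n x @[n --> \oo] --> g x.
  apply: filterS (integrable_ae measurableT intD) => x /(_ I).
  set S := (X in X \is a fin_num) => Sfin.
  have S0 : 0 <= fine S by rewrite fine_ge0// nneseries_ge0// => n _ _;
    exact: D0.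
  have dle k : `|u k.+1 x - u k x| <= geometric (Num.sqrt (fine S)) 2^-1 k.
    have Dk : (D k x <= S)%E.
      apply: le_trans (nneseries_lim_ge k.+1 _); last by move=> *; exact: D0.
      by rewrite big_nat_recr//= leeDr// sume_ge0// => *; exact: D0.
    move: Dk; rewrite -(fineK Sfin) /D lee_fin => Dk.
    rewrite /geometric/= exprVn ler_pdivlMr ?exprn_gt0//.
    rewrite -[leLHS]ger0_norm ?mulr_ge0 ?exprn_ge0// -sqrtr_sqr.
    rewrite ler_wsqrtr// (le_trans _ Dk)// exprMn real_normK ?num_real// mulrC.
    by rewrite exprAC -[2 ^+ 2]natrX.
  have /cvg_ex[l ul] : cvgn (fun n => u n x).
    rewrite (_ : (fun n => _) =
      (fun n => u 0%N x + series (telescope (u ^~ x)) n)).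
      apply: is_cvgD; first exact: is_cvg_cst.
      apply: normed_cvg; apply: series_le_cvg dle _ => //.
      - by move=> n; rewrite /geometric/= mulr_ge0 ?sqrtr_ge0 ?exprn_ge0.
      - by apply: is_cvg_geometric_series; rewrite ger0_norm; lra.
    by apply/funext => n; rewrite -(eq_sum_telescope (u ^~ x)).
  rewrite /g (_ : limn_esup _ = l%:E)//.
  by apply: (cvg_limn_einf_sup _).2; apply: cvg_EFin => //; exact: nearW.
have key n : (\int[mu]_x ((u n x - g x) ^+ 2)%:E <= (8^-1 ^+ n)%:E)%E.
  pose F m x := ((u n x - u m x) ^+ 2)%:E : \bar R.
  have mF m : measurable_fun setT (F m).
    by apply/measurable_EFinP; apply: measurable_funX;
      case: (sqintB _ _ (su n) (su m)).
  have F0 m x : setT x -> (0 <= F m x)%E by rewrite lee_fin sqr_ge0.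
  rewrite (ae_eq_integral (fun x => limn_einf (F ^~ x))).
  - apply: le_trans (fatou mu measurableT mF F0) _.
    apply: (@limn_einf_le _ n) => m nm; rewrite /F -nrm2E ?lee_fin ?uC//.
    exact: sqintB.
  - by [].
  - by apply/measurable_EFinP; apply: measurable_funX;
      apply: measurable_funB => //; case: (su n).
  - rewrite (_ : (fun x => _) = (fun x => - limn_esup (fun m => - F m x)))%E//.
    apply: measurableT_comp => //; apply: measurable_fun_limn_esup => m.
    exact: measurableT_comp.
  apply: filterS ug => x ux _; apply/esym/(cvg_limn_einf_sup _).1.
  apply: cvg_EFin; first exact: nearW.
  under eq_fun => m do rewrite /F/= expr2.
  by rewrite expr2; apply: cvgM; apply: cvgB => //; exact: cvg_cst.
have sug n : sqint (fun x => u n x - g x).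
  split; first by apply: measurable_funB => //; case: (su n).
  by apply: le_lt_trans (key n) _; rewrite ltry.
exists g; split.
  rewrite (_ : g = (fun x => u 0%N x - (u 0%N x - g x))); first exact: sqintB.
  by apply/funext => x; ring.
by move=> n; rewrite -lee_fin nrm2E.
Qed.

Lemma le_geometric_le0 (c x : R) : (forall n, x <= c * 8^-1 ^+ n) -> x <= 0.
Proof.
move=> h.
have c0 : geometric c (8^-1 : R) @ \oo --> 0.
  by apply: cvg_geometric; rewrite ger0_norm; lra.
rewrite -(cvg_lim _ c0)//; apply: limr_ge; first exact: cvgP c0.
exact: nearW.
Qed.

Lemma quadratic_eq0 (x b : R) : 0 <= b -> (forall t, t * x <= t ^+ 2 * b) ->
  x = 0.
Proof.
move=> b0 /(_ (x / (b + 1))); have b1 : b + 1 != 0 by lra.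
rewrite -subr_le0.
have -> : x / (b + 1) * x - (x / (b + 1)) ^+ 2 * b = (x / (b + 1)) ^+ 2
  by field.
move=> x2; have : x / (b + 1) == 0 by rewrite -sqrf_eq0 eq_le x2 sqr_ge0.
by rewrite mulf_eq0 invr_eq0 (negbTE b1) orbF => /eqP.
Qed.

Lemma nrm2_eq0_inner f g : sqint f -> sqint g -> nrm2 f = 0 -> inner f g = 0.
Proof.
move=> sf sg f0; apply: (@quadratic_eq0 _ (2^-1 * nrm2 g)).
  by rewrite mulr_ge0// nrm2_ge0.
move=> t; have := inner_le f (fun x => t * g x) sf (sqintZ _ _ sg).
by rewrite f0 innerZr// nrm2Z//; lra.
Qed.

Lemma nrm2_le f g : sqint f -> sqint g -> (forall x, `|f x| <= `|g x|) ->
  nrm2 f <= nrm2 g.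
Proof.
move=> sf sg fg; rewrite -lee_fin !nrm2E//; apply: ge0_le_integral => //.
- by move=> x _; rewrite lee_fin sqr_ge0.
- by apply/measurable_EFinP; apply: measurable_funX; case: sf.
- by apply/measurable_EFinP; apply: measurable_funX; case: sg.
- move=> x _; rewrite lee_fin -(real_normK (num_real (f x))).
  by rewrite -(real_normK (num_real (g x))) lerXn2r// nnegrE.
Qed.

(** Weighing [f] by [s] in the variational inequality gives a bound that is
    linear in [s] without taking square roots of norms. *)
Lemma inner_bound f g h (s : R) : sqint f -> sqint g -> sqint h -> 0 <= s ->
  (forall x, `|g x| <= s * `|h x|) -> `|inner f g| <= s * (nrm2 f + nrm2 h).
Proof.
move=> sf sg sh s0 gh.
have ng : nrm2 g <= s ^+ 2 * nrm2 h.
  rewrite -nrm2Z//; apply: nrm2_le => //; first exact: sqintZ.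
  by move=> x; rewrite normrM (ger0_norm s0).
have f0 := nrm2_ge0 f; have h0 := nrm2_ge0 h; have g0 := nrm2_ge0 g.
move: s0; rewrite le_eqVlt => /predU1P[s0|s0].
  suff -> : inner f g = 0 by rewrite normr0 mulr_ge0// ?addr_ge0// -s0.
  rewrite innerC; apply: nrm2_eq0_inner => //.
  by apply/eqP; rewrite eq_le g0 (le_trans ng)// -s0 expr0n mul0r.
have i1 := inner_le (fun x => s * f x) g (sqintZ _ _ sf) sg.
have i2 := inner_le (fun x => - s * f x) g (sqintZ _ _ sf) sg.
rewrite innerZl// nrm2Z// in i1; rewrite innerZl// nrm2Z// in i2.
rewrite -(ler_pM2l s0) -[X in X * `|_|](gtr0_norm s0) -normrM ler_norml.
by apply/andP; split; nra.
Qed.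

(** A maximizing sequence of the concave functional [2 l p - nrm2 p] is Cauchy
    by the parallelogram identity, and the stationarity of its limit is the
    representation formula.  The subspace need not be closed, and the last
    clause says that the maximum of the functional is the square norm of the
    representing function. *)
Lemma riesz_subspace (D : set (T -> R)) (l : (T -> R) -> R) (M : R) :
  D (fun=> 0) -> D `<=` sqint ->
  (forall a b p q, D p -> D q -> D (fun x => a * p x + b * q x)) ->
  (forall a b p q, D p -> D q ->
     l (fun x => a * p x + b * q x) = a * l p + b * l q) ->
  (forall p, D p -> 2 * l p - nrm2 p <= M) ->
  exists g, [/\ sqint g, forall p, D p -> l p = inner g p &
    forall M', (forall p, D p -> 2 * l p - nrm2 p <= M') -> nrm2 g <= M'].
Proof.
move=> D0 Dsq Dlin llin lM.
pose J p := 2 * l p - nrm2 p.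
pose S := sup [set J p | p in D].
have hS : has_sup [set J p | p in D].
  by split; [exists (J (fun=> 0)), (fun=> 0) | exists M => _ [p /lM ? <-]].
have JS p : D p -> J p <= S by move=> Dp; apply: ub_le_sup (hS.2) _ _; exists p.
have /choice[u uP] n : exists p, D p /\ S - 8^-1 ^+ n / 4 < J p.
  have [|_ [p Dp <-] Jp] := @sup_adherent _ _ (8^-1 ^+ n / 4) _ hS.
    by rewrite divr_gt0// exprn_gt0// invr_gt0.
  by exists p.
have Du n : D (u n) by case: (uP n).
have su n : sqint (u n) by exact: Dsq.
have uC n m : (n <= m)%N -> nrm2 (fun x => u n x - u m x) <= 8^-1 ^+ n.
  move=> nm; have mn : 8^-1 ^+ m <= 8^-1 ^+ n :> R.
    by apply: ler_wiXn2l => //; lra.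
  have := JS _ (Dlin 2^-1 2^-1 _ _ (Du n) (Du m)).
  rewrite /J llin// nrm2_lin// nrm2B//.
  have := (uP n).2; have := (uP m).2; rewrite /J.
  lra.
have [g [sg ug]] := riesz_fischer u su uC.
have ug' n : nrm2 (fun x => u n x - g x) = nrm2 (u n) - 2 * inner g (u n) +
  nrm2 g.
  by rewrite nrm2B// (innerC g).
have lg p : D p -> l p = inner g p.
  move=> Dp; have sp := Dsq _ Dp.
  set a := l p - inner g p.
  (* A step from [u n] in the direction [p] cannot exceed the supremum. *)
  have key t : 2 * t * a - 2 * t ^+ 2 * nrm2 p <= 0.
    apply: (@le_geometric_le0 2) => n.
    have := JS _ (Dlin 1 t _ _ (Du n) Dp).
    rewrite /J llin// nrm2_lin//.
    have := inner_le (fun x => u n x - g x) (fun x => t * p x)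
       (sqintB _ _ (su n) sg) (sqintZ _ _ sp).
    rewrite innerZr ?innerBl ?nrm2Z//; last exact: sqintB.
    have := (uP n).2; rewrite /J; have := ug n; rewrite /a.
    have : 0 <= 8^-1 ^+ n :> R by rewrite exprn_ge0.
    nra.
  suff : a = 0 by rewrite /a; lra.
  apply: (@quadratic_eq0 _ (nrm2 p)); first exact: nrm2_ge0.
  by move=> t; have := key t; lra.
exists g; split => // M' hM'.
rewrite -subr_le0; apply: (@le_geometric_le0 1) => n; rewrite mul1r.
by have := hM' _ (Du n); have := ug n; rewrite ug' lg//; lra.
Qed.

End L2space.

(** * Smooth functions and test functions in the plane *)

Section FlatFunction.
Context {R : realType}.
Implicit Types (p : {poly R}) (x : R).

(** The functions [q (1 / x) exp (- 1 / x)], extended by [0] to the left of the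
    origin, form a class that is closed under differentiation.  It contains
    the flat function [exp (- 1 / x)] from which all bumps are built. *)
Definition flat p x : R := if 0 < x then p.[x^-1] * expR (- x^-1) else 0.

Definition dflat p : {poly R} := 'X^2 * (p - p^`()).

(** Each monomial times [y ^+ 2] is dominated by the term of the exponential
    series that has the same degree. *)
Lemma horner_expR_bounded p :
  exists2 C, 0 <= C & forall y : R, 0 <= y -> `|p.[y]| * y ^+ 2 <= C * expR y.
Proof.
exists (\sum_(i < size p) `|p`_i| * (i.+2)`!%:R).
  by apply: sumr_ge0 => i _; rewrite mulr_ge0.
move=> y y0; rewrite horner_coef.
apply: (@le_trans _ _ ((\sum_(i < size p) `|p`_i| * y ^+ i) * y ^+ 2)).
  rewrite ler_wpM2r ?exprn_ge0// (le_trans (ler_norm_sum _ _ _))//.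
  by apply: ler_sum => i _; rewrite normrM (ger0_norm (exprn_ge0 _ y0)).
rewrite !mulr_suml; apply: ler_sum => i _.
rewrite -!mulrA ler_wpM2l// -exprD addn2 -ler_pdivrMl ?ltr0n ?fact_gt0//.
rewrite mulrC; apply: le_trans (expR_ge1Dxn i.+1 y0).
by rewrite lerDr.
Qed.

Lemma flat_sqr_le p : exists2 C, 0 <= C & forall x, `|flat p x| <= C * x ^+ 2.
Proof.
have [C C0 hC] := horner_expR_bounded p; exists C => // x; rewrite /flat.
case: ifPn => [x0|_]; last by rewrite normr0 mulr_ge0 ?sqr_ge0.
have y0 : 0 < x^-1 by rewrite invr_gt0.
rewrite normrM (ger0_norm (expR_ge0 _)) expRN.
rewrite ler_pdivrMr ?expR_gt0// mulrAC -ler_pdivrMr ?exprn_gt0//.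
by rewrite -exprVn; exact: hC (ltW y0).
Qed.

Lemma is_derive_flat p x : is_derive x 1 (flat p) (flat (dflat p) x).
Proof.
have [x0|x0|->] := ltgtP x 0.
- have -> : flat (dflat p) x = 0 by rewrite /flat ltNge (ltW x0).
  apply: (@near_eq_is_derive _ _ _ (cst 0)).
  near=> y; rewrite /flat ifF//; apply/negbTE; rewrite -leNgt ltW//.
  by near: y; exact: lt_nbhsl.
- have -> : flat (dflat p) x = (dflat p).[x^-1] * expR (- x^-1)
    by rewrite /flat x0.
  have xn0 : x != 0 by rewrite gt_eqF.
  have dV := is_deriveV xn0 (is_derive_id x 1).
  have dN : is_derive x 1 (fun y : R => - y^-1) (x ^- 2).
    by apply: is_derive_eq; rewrite scaleNr opprK; exact: mulr1.
  have dE := is_derive1_comp (g := fun y : R => - y^-1)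
    (is_derive_expR (- x^-1)) dN.
  have dp := is_derive1_comp (g := fun y : R => y^-1) (is_derive_poly p x^-1)
    dV.
  have dF : is_derive x 1 (fun y => p.[y^-1] * expR (- y^-1))
      ((dflat p).[x^-1] * expR (- x^-1)).
    have dM := is_deriveM dp dE.
    rewrite (_ : _ * _ = p.[x^-1] *: (expR (- x^-1) * x ^- 2) +
       expR (- x^-1) *: (p^`().[x^-1] * (- x ^- 2)%:A)); first exact: dM.
    rewrite /dflat hornerM hornerXn hornerD hornerN.
    rewrite /GRing.scale/= exprVn; ring.
  apply: near_eq_is_derive dF.
  by near=> y; rewrite /flat ifT//; near: y; exact: lt_nbhsr.
- have -> : flat (dflat p) 0 = 0 by rewrite /flat ltxx.
  have [C C0 hC] := flat_sqr_le p.
  have F0 : flat p 0 = 0 by rewrite /flat ltxx.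
  suff h : h^-1 *: ((flat p \o shift 0) (h *: 1) - flat p 0) @[h --> 0^'] --> 0.
    by split; [apply/cvg_ex; exists 0|apply/cvg_lim].
  apply/cvgrPdist_le => e e0; near=> h.
  have h0 : h != 0 by near: h; exact: nbhs_dnbhs_neq.
  rewrite sub0r normrN /= F0 addr0 subr0 [h *: 1]mulr1 [_ *: _]/(_ * _).
  rewrite normrM normfV ler_pdivrMl ?normr_gt0//.
  apply: le_trans (hC h) _; rewrite -(real_normK (num_real h)) expr2 mulrCA.
  rewrite ler_wpM2l//; apply: (@le_trans _ _ ((C + 1) * `|h|)).
    by rewrite ler_wpM2r// lerDl.
  rewrite -ler_pdivlMl ?ltr_wpDl//.
  near: h; apply: dnbhs0_le.
  by rewrite mulr_gt0// invr_gt0 ltr_wpDl.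
Unshelve. all: end_near. Qed.

End FlatFunction.

Section Smooth.
Context {R : realType}.
Implicit Types (p q : R * R -> R) (z h : R * R).
Local Notation e1 := (e1 R).
Local Notation e2 := (e2 R).

Definition smooth p := forall k, is_Ck k p.

Lemma is_derive_e1 p x y d :
  is_derive (x, y) e1 p d <-> is_derive x 1 (fun t => p (t, y)) d.
Proof.
suff E : (fun h : R => h^-1 *: ((p \o shift (x, y)) (h *: e1) - p (x, y))) =
    (fun h : R =>
      h^-1 *: (((fun t => p (t, y)) \o shift x) (h *: 1) - p (x, y))).
  by split => -[]; rewrite /derivable /derive /= -?E ?E => ? ?; split;
    rewrite /derivable /derive -?E ?E.
apply/funext => h /=; congr (_ *: (p _ - _)).
rewrite /Defs.e1 /shift/=; congr (_, _).
exact: (etrans (congr1 (+%R^~ y) (mulr0 h)) (add0r y)).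
Qed.

Lemma is_derive_e2 p x y d :
  is_derive (x, y) e2 p d <-> is_derive y 1 (fun t => p (x, t)) d.
Proof.
suff E : (fun h : R => h^-1 *: ((p \o shift (x, y)) (h *: e2) - p (x, y))) =
    (fun h : R =>
      h^-1 *: (((fun t => p (x, t)) \o shift y) (h *: 1) - p (x, y))).
  by split => -[]; rewrite /derivable /derive /= -?E ?E => ? ?; split;
    rewrite /derivable /derive -?E ?E.
apply/funext => h /=; congr (_ *: (p _ - _)).
rewrite /Defs.e2 /shift/=; congr (_, _).
exact: (etrans (congr1 (+%R^~ x) (mulr0 h)) (add0r x)).
Qed.

(** Differentiability of all orders is a coinductive property, so that it can
    be proved by exhibiting a class of functions that is closed under the two
    partial derivatives. *)
Lemma smooth_coind (S : set (R * R -> R)) :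
  (forall p, S p -> continuous p /\ exists p1 p2, [/\ S p1, S p2,
     forall z, is_derive z e1 p (p1 z) & forall z, is_derive z e2 p (p2 z)]) ->
  S `<=` smooth.
Proof.
move=> hS p Sp k; elim: k p Sp => [|k ih] p Sp /=; first by case: (hS p Sp).
have [_ [p1 [p2 [S1 S2 d1 d2]]]] := hS p Sp.
split.
- by move=> z; split; [case: (d1 z)|case: (d2 z)].
- rewrite (_ : (fun z => _) = p1); first exact: ih.
  by apply/funext => z; exact: derive_val.
- rewrite (_ : (fun z => _) = p2); first exact: ih.
  by apply/funext => z; exact: derive_val.
Qed.

Lemma smooth_continuous p : smooth p -> continuous p.
Proof. by move=> /(_ 0%N). Qed.

Lemma smooth_d1 p : smooth p -> smooth (fun z => 'D_e1 p z).
Proof. by move=> sp k; have [] := sp k.+1. Qed.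

Lemma smooth_d2 p : smooth p -> smooth (fun z => 'D_e2 p z).
Proof. by move=> sp k; have [] := sp k.+1. Qed.

Lemma smooth_is_derive1 p z : smooth p -> is_derive z e1 p ('D_e1 p z).
Proof. by move=> sp; have [/(_ z)[? ?] _ _] := sp 1%N; apply: derivableP. Qed.

Lemma smooth_is_derive2 p z : smooth p -> is_derive z e2 p ('D_e2 p z).
Proof. by move=> sp; have [/(_ z)[? ?] _ _] := sp 1%N; apply: derivableP. Qed.

Lemma smooth_lin (a b : R) p q : smooth p -> smooth q ->
  smooth (fun z => a * p z + b * q z).
Proof.
move=> sp sq.
pose S := [set r : R * R -> R | exists p q, [/\ smooth p, smooth q &
   r = (fun z => a * p z + b * q z)]].
apply: (smooth_coind S); last by exists p, q.
move=> _ {sp sq p q} [p [q [sp sq ->]]]; split.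
  move=> z; apply: cvgD; apply: cvgM; try exact: cvg_cst.
  - exact: smooth_continuous sp _.
  - exact: smooth_continuous sq _.
exists (fun z => a * 'D_e1 p z + b * 'D_e1 q z).
exists (fun z => a * 'D_e2 p z + b * 'D_e2 q z).
split.
- by eexists; eexists; split; [exact: smooth_d1 sp|exact: smooth_d1 sq|].
- by eexists; eexists; split; [exact: smooth_d2 sp|exact: smooth_d2 sq|].
- move=> z; have d1 := smooth_is_derive1 p z sp;
    have d2 := smooth_is_derive1 q z sq.
  exact: (is_deriveD (is_deriveZ a d1) (is_deriveZ b d2)).
- move=> z; have d1 := smooth_is_derive2 p z sp;
    have d2 := smooth_is_derive2 q z sq.
  exact: (is_deriveD (is_deriveZ a d1) (is_deriveZ b d2)).
Qed.

Lemma is_Ck_add k p q : is_Ck k p -> is_Ck k q -> is_Ck k (fun z => p z + q z).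
Proof.
elim: k p q => [|k ih] p q /=.
  by move=> cp cq z; apply: cvgD; [exact: cp|exact: cq].
move=> [dp dp1 dp2] [dq dq1 dq2]; split.
- by move=> z; have [? ?] := dp z; have [? ?] := dq z; split; apply: derivableD.
- rewrite (_ : (fun z => _) = (fun z => 'D_e1 p z + 'D_e1 q z));
    first exact: ih.
  by apply/funext => z; apply: deriveD; [case: (dp z)|case: (dq z)].
- rewrite (_ : (fun z => _) = (fun z => 'D_e2 p z + 'D_e2 q z));
    first exact: ih.
  by apply/funext => z; apply: deriveD; [case: (dp z)|case: (dq z)].
Qed.

Lemma smooth_mul p q : smooth p -> smooth q -> smooth (fun z => p z * q z).
Proof.
move=> sp sq k; elim: k p q sp sq => [|k ih] p q sp sq /=.
  by move=> z; apply: cvgM; exact: smooth_continuous.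
have d1 z : is_derive z e1 (fun z => p z * q z)
  (p z * 'D_e1 q z + q z * 'D_e1 p z).
  exact: (is_deriveM (smooth_is_derive1 p z sp) (smooth_is_derive1 q z sq)).
have d2 z : is_derive z e2 (fun z => p z * q z)
  (p z * 'D_e2 q z + q z * 'D_e2 p z).
  exact: (is_deriveM (smooth_is_derive2 p z sp) (smooth_is_derive2 q z sq)).
split.
- by move=> z; split; [case: (d1 z)|case: (d2 z)].
- rewrite (_ : (fun z => _) = (fun z => p z * 'D_e1 q z + q z * 'D_e1 p z)).
    by apply: is_Ck_add; apply: ih => //; exact: smooth_d1.
  by apply/funext => z; exact: derive_val.
- rewrite (_ : (fun z => _) = (fun z => p z * 'D_e2 q z + q z * 'D_e2 p z)).
    by apply: is_Ck_add; apply: ih => //; exact: smooth_d2.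
  by apply/funext => z; exact: derive_val.
Qed.

Lemma is_derive_translate p h v z d :
  is_derive (z + h) v p d -> is_derive z v (fun z => p (z + h)) d.
Proof.
suff E :
    (fun t : R =>
      t^-1 *: (((fun z => p (z + h)) \o shift z) (t *: v) - p (z + h))) =
    (fun t : R => t^-1 *: ((p \o shift (z + h)) (t *: v) - p (z + h))).
  by move=> -[]; rewrite /derivable /derive => ? ?; split;
    rewrite /derivable /derive E.
by apply/funext => t /=; rewrite /shift/= addrA.
Qed.

Lemma derive_translate p h v z : 'D_v (fun z => p (z + h)) z = 'D_v p (z + h).
Proof.
have E :
    (fun t : R =>
      t^-1 *: (((fun z => p (z + h)) \o shift z) (t *: v) - p (z + h))) =
    (fun t : R => t^-1 *: ((p \o shift (z + h)) (t *: v) - p (z + h))).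
  by apply/funext => t /=; rewrite /shift/= addrA.
by rewrite /derive E.
Qed.

Lemma smooth_translate p h : smooth p -> smooth (fun z => p (z + h)).
Proof.
move=> sp; pose S := [set r | exists2 p, smooth p & r = (fun z => p (z + h))].
apply: (smooth_coind S); last by exists p.
move=> _ {sp p} [p sp ->]; split.
  move=> z; apply: (cvg_comp (fun z => z + h));
    last exact: smooth_continuous sp _.
  by apply: cvgD; [exact: cvg_id|exact: cvg_cst].
exists (fun z => 'D_e1 p (z + h)), (fun z => 'D_e2 p (z + h)); split.
- by exists (fun z => 'D_e1 p z) => //; exact: smooth_d1.
- by exists (fun z => 'D_e2 p z) => //; exact: smooth_d2.
- by move=> z; apply: is_derive_translate; exact: smooth_is_derive1.
- by move=> z; apply: is_derive_translate; exact: smooth_is_derive2.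
Qed.

Lemma smooth_flat_fst (a b : R) : smooth (fun z => flat 1 (a * z.1 + b)).
Proof.
pose S := [set r | exists c (p : {poly R}), r =
  (fun z : R * R => c * flat p (a * z.1 + b))].
have -> : (fun z : R * R => flat 1 (a * z.1 + b)) =
    (fun z => 1 * flat 1 (a * z.1 + b)) by apply/funext => z; rewrite mul1r.
apply: (smooth_coind S); last by exists 1, 1.
move=> _ [c [p ->]].
have dA (x : R) : is_derive x 1 (fun t : R => c * flat p (a * t + b))
    (c * a * flat (dflat p) (a * x + b)).
  have da : is_derive x 1 (fun t : R => a * t + b) a.
    apply: is_derive_eq.
    by rewrite addr0 [_ *: _]mulr1.
  have df := is_derive1_comp (g := fun t => a * t + b)
    (is_derive_flat p (a * x + b)) da.
  rewrite (_ : c * a * _ = c *: (flat (dflat p) (a * x + b) * a)).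
    exact: is_deriveZ.
  by rewrite [RHS]/(_ * _) -mulrA [a * _]mulrC.
split.
  move=> z.
  apply: (@continuous_comp _ _ _ (fun z => z.1)
    (fun t : R => c * flat p (a * t + b))).
    exact: cvg_fst.
  by apply: differentiable_continuous; apply/derivable1_diffP; case: (dA z.1).
exists (fun z => c * a * flat (dflat p) (a * z.1 + b)).
exists (fun z => 0 * flat p (a * z.1 + b)); split.
- by exists (c * a), (dflat p).
- by exists 0, p.
- by move=> [x y]; apply/is_derive_e1; exact: dA.
- by move=> [x y]; apply/is_derive_e2; rewrite mul0r;
  exact: (is_derive_cst (c * flat p (a * x + b))).
Qed.

Lemma smooth_swap p : smooth p -> smooth (fun z => p (z.2, z.1)).
Proof.
move=> sp; pose S := [set r | exists2 p, smooth p & r =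
  (fun z : R * R => p (z.2, z.1))].
apply: (smooth_coind S); last by exists p.
move=> _ {sp p} [p sp ->]; split.
  move=> z; apply: (cvg_comp (fun z : R * R => (z.2, z.1)) p).
    by apply: (@cvg_pair _ _ _ _ (nbhs z.2) (nbhs z.1));
      [exact: cvg_snd|exact: cvg_fst].
  exact: smooth_continuous sp _.
exists (fun z => 'D_e2 p (z.2, z.1)), (fun z => 'D_e1 p (z.2, z.1)); split.
- by exists (fun z => 'D_e2 p z) => //; exact: smooth_d2.
- by exists (fun z => 'D_e1 p z) => //; exact: smooth_d1.
- move=> [x y]; apply/is_derive_e1; apply/is_derive_e2 => /=.
  exact: smooth_is_derive2.
- move=> [x y]; apply/is_derive_e2; apply/is_derive_e1 => /=.
  exact: smooth_is_derive1.
Qed.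

Lemma smooth_flat_snd (a b : R) : smooth (fun z => flat 1 (a * z.2 + b)).
Proof. exact: smooth_swap (smooth_flat_fst a b). Qed.

End Smooth.

Section OpenMeasurable.
Context {R : realType}.
Local Notation T2 := (measurableTypeR R * measurableTypeR R)%type.

Lemma open2_measurable (U : set (R * R)) : open U -> measurable (U : set T2).
Proof.
move=> oU.
pose F (i : rat * rat * nat) : set T2 :=
  let B := ball (ratr i.1.1 : R) i.2.+1%:R^-1 `*` ball (ratr i.1.2 : R)
    i.2.+1%:R^-1 in
  if `[< B `<=` U >] then B else set0.
have -> : (U : set T2) = \bigcup_i F i.
  apply/seteqP; split => [[x y] Uxy|z [i _]]; last first.
    by rewrite /F; case: asboolP => // BU; exact: BU.
  have [[/= A B] [Ax By] ABU] := oU _ Uxy.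
  have [e1 /= e10 hA] := (nbhs_ballP _ _).1 Ax.
  have [e2 /= e20 hB] := (nbhs_ballP _ _).1 By.
  pose e := Num.min e1 e2 / 2; have e0 : 0 < e by rewrite divr_gt0// lt_min e10.
  pose n := Num.truncn e^-1; have ne : n.+1%:R^-1 < e.
    by rewrite invf_plt ?posrE// truncnS_gt.
  have n0 : 0 < n.+1%:R^-1 :> R by rewrite invr_gt0.
  have rat_near (t : R) : exists q : rat, `|ratr q - t| < n.+1%:R^-1.
    have [|q] := @rat_in_itvoo R (t - n.+1%:R^-1) (t + n.+1%:R^-1).
      by rewrite ltrBlDr -addrA ltrDl addr_gt0.
    by rewrite in_itv/= => /andP[h1 h2]; exists q; rewrite ltr_distl h1.
  have [a ha] := rat_near x; have [b hb] := rat_near y.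
  exists (a, b, n) => //; rewrite /F; case: asboolP => /= [_|]; first by split.
  case=> -[u v] [/= hu hv]; apply: ABU; split => /=; [apply: hA|apply: hB].
  - have /lt_le_trans : n.+1%:R^-1 + n.+1%:R^-1 < Num.min e1 e2.
      by rewrite (splitr (Num.min e1 e2)) ltrD.
    move=> /(_ e1); rewrite ge_min lexx => /(_ isT) /ltW h.
    rewrite -ball_normE /=; apply: lt_le_trans h.
    by rewrite (le_lt_trans (ler_distD (ratr a) _ _))// ltrD// distrC.
  - have /lt_le_trans : n.+1%:R^-1 + n.+1%:R^-1 < Num.min e1 e2.
      by rewrite (splitr (Num.min e1 e2)) ltrD.
    move=> /(_ e2); rewrite ge_min lexx orbT => /(_ isT) /ltW h.
    rewrite -ball_normE /=; apply: lt_le_trans h.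
    by rewrite (le_lt_trans (ler_distD (ratr b) _ _))// ltrD// distrC.
apply: countable_bigcupT_measurable => // i; rewrite /F; case: asboolP => // _.
by apply: measurableX; exact: measurable_ball.
Qed.

Lemma continuous2_measurable (f : R * R -> R) :
  continuous f -> measurable_fun setT (f : T2 -> R).
Proof.
move=> /continuousP cf; apply: (measurability _ (RGenOpens.measurableE R)).
move=> _ [_ [a [b ->]] <-].
by rewrite setTI; apply: open2_measurable; apply: cf; exact: interval_open.
Qed.
End OpenMeasurable.

Section TestFunctions.
Context {R : realType}.
Implicit Types (p q : R * R -> R) (z h : R * R).
Local Notation e1 := (e1 R).
Local Notation e2 := (e2 R).

Definition bsupp p := exists N : R,
  forall z, p z != 0 -> `|z.1| <= N /\ `|z.2| <= N.

Definition box (N : R) : set (R * R) := `[- N, N] `*` `[- N, N].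

Lemma boxP N z : box N z <-> `|z.1| <= N /\ `|z.2| <= N.
Proof. by rewrite /box /= !in_itv/= !ler_norml; split => -[]. Qed.

Lemma box_compact N : compact (box N).
Proof. by apply: compact_setX; exact: segment_compact. Qed.

Lemma bsuppP p : bsupp p <-> compact (closure [set z | p z != 0]).
Proof.
split=> [[N hN]|/compact_bounded].
  apply: (@subclosed_compact _ _ (box N)).
  - exact: closed_closure.
  - exact: box_compact.
  - have /closure_id -> : closed (box N).
      by apply: compact_closed; [exact: norm_hausdorff|exact: box_compact].
    by apply: closure_subset => z /hN /boxP.
move=> [M [_ hM]]; exists (M + 1) => z pz.
have /= : `|z| <= M + 1.
  by apply: (hM (M + 1)); [rewrite ltrDl|exact: subset_closure].
by rewrite prod_normE ge_max => /andP[].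
Qed.

Lemma testP p : test_function p <-> smooth p /\ bsupp p.
Proof. by rewrite /test_function -bsuppP. Qed.

End TestFunctions.

Section MeanValue.
Context {R : realType}.

Lemma mean_value (f df : R -> R) (a b : R) :
  (forall x : R, is_derive x 1 f (df x)) ->
  exists2 c, `|c - a| <= `|b - a| & f b - f a = (b - a) * df c.
Proof.
move=> fdf.
have fc x : {for x, continuous f}.
  by apply: differentiable_continuous; apply/derivable1_diffP; case: (fdf x).
have key (u v : R) : u <= v -> exists2 c, u <= c <= v & f v - f u =
  (v - u) * df c.
  move=> uv; have [|c] := @MVT_segment R f df u v uv (fun x _ => fdf x).
    by apply: continuous_in_subspaceT => x _; exact: fc.
  by rewrite in_itv/= => cuv ->; exists c; rewrite // mulrC.
have [ab|/ltW ba] := leP a b.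
  have [c /andP[ac cb] e] := key _ _ ab; exists c => //.
  by rewrite !ger0_norm ?subr_ge0// lerD2r.
have [c /andP[bc ca] e] := key _ _ ba; exists c.
  by rewrite !ler0_norm ?subr_le0// !opprB lerD2l lerN2.
by rewrite -opprB e -mulNr opprB.
Qed.

End MeanValue.

Section TestCalculus.
Context {R : realType}.
Implicit Types (p q : R * R -> R) (z h : R * R).
Local Notation e1 := (e1 R).
Local Notation e2 := (e2 R).

Lemma test_smooth p : test_function p -> smooth p.
Proof. by move=> /testP[]. Qed.

Lemma test0 : test_function (fun=> 0 : R).
Proof.
apply/testP; split; last by exists 0 => z; rewrite eqxx.
apply: (smooth_coind [set (fun=> 0)]) => // _ ->; split;
  first exact: cst_continuous.
by exists (fun=> 0), (fun=> 0); split => // z; exact: is_derive_cst.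
Qed.

Lemma test_lin (a b : R) p q : test_function p -> test_function q ->
  test_function (fun z => a * p z + b * q z).
Proof.
move=> /testP[sp [N hN]] /testP[sq [M hM]]; apply/testP; split.
  exact: smooth_lin.
exists (Num.max N M) => z; have [pz|/hN[? ?] _] := eqVneq (p z) 0.
  rewrite pz mulr0 add0r => abq; have /hM[] : q z != 0.
    by apply: contra_neq abq => ->; rewrite mulr0.
  by rewrite !le_max => -> ->; rewrite !orbT.
by rewrite !le_max; split; apply/orP; left.
Qed.

Lemma test_translate p h : test_function p ->
  test_function (fun z => p (z + h)).
Proof.
move=> /testP[sp [N hN]]; apply/testP; split; first exact: smooth_translate.
exists (N + Num.max `|h.1| `|h.2|) => z /hN[/= h1 h2]; split.
  rewrite -[z.1](addrK h.1) (le_trans (ler_normB _ _))// lerD//.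
  by rewrite le_max lexx.
rewrite -[z.2](addrK h.2) (le_trans (ler_normB _ _))// lerD//.
by rewrite le_max lexx orbT.
Qed.

Lemma bsupp_locally p : bsupp p -> exists N, forall z,
  ~ box N z -> \forall w \near z, p w = 0.
Proof.
move=> [N hN]; exists N => z nz.
have oB : open (~` (box N : set (R * R))).
  rewrite openC; apply: compact_closed;
    [exact: norm_hausdorff|exact: box_compact].
have : \forall w \near z, (~` box N) w by exact: oB.
apply: filterS => w /= Bw; apply: contra_notP Bw => /eqP /hN ?.
exact/boxP.
Qed.

Lemma test_d1 p : test_function p -> test_function (fun z => 'D_e1 p z).
Proof.
move=> /testP[sp /bsupp_locally[N hN]]; apply/testP; split;
  first exact: smooth_d1.
exists N => z; case: (pselect (box N z)) => [/boxP//|/hN pz].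
by rewrite (near_eq_derive e1 (g := cst 0) pz) derive_cst eqxx.
Qed.

Lemma test_d2 p : test_function p -> test_function (fun z => 'D_e2 p z).
Proof.
move=> /testP[sp /bsupp_locally[N hN]]; apply/testP; split;
  first exact: smooth_d2.
exists N => z; case: (pselect (box N z)) => [/boxP//|/hN pz].
by rewrite (near_eq_derive e2 (g := cst 0) pz) derive_cst eqxx.
Qed.

Lemma test_bounded p : test_function p -> exists2 M, 0 <= M & forall z,
  `|p z| <= M.
Proof.
move=> /testP[sp [N hN]].
have /compact_bounded[M [_ hM]] : compact (p @` box N).
  apply: continuous_compact (box_compact N).
  exact/continuous_subspaceT/smooth_continuous.
exists (`|M| + 1); first by rewrite addr_ge0.
move=> z; have [->|pz] := eqVneq (p z) 0; first by rewrite normr0 addr_ge0.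
apply: (hM (`|M| + 1)); first by rewrite (le_lt_trans (ler_norm M))// ltrDl.
by exists z => //; apply/boxP; exact: hN.
Qed.

Lemma test_lipschitz p : test_function p -> exists2 M, 0 <= M &
  forall z h, `|p (z + h) - p z| <= M * (`|h.1| + `|h.2|).
Proof.
move=> tp; have sp := test_smooth _ tp.
have [M1 M10 h1] := test_bounded _ (test_d1 _ tp).
have [M2 M20 h2] := test_bounded _ (test_d2 _ tp).
exists (M1 + M2); first exact: addr_ge0.
move=> [x y] [u v]; rewrite /= -[(x, y) + (u, v)]/(x + u, y + v).
have [c1 _ E1] := @mean_value R _ _ x (x + u)
   (fun t => (is_derive_e1 p t (y + v) _).1 (smooth_is_derive1 _ _ sp)).
have [c2 _ E2] := @mean_value R _ _ y (y + v)
   (fun t => (is_derive_e2 p x t _).1 (smooth_is_derive2 _ _ sp)).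
have Eu : x + u - x = u by rewrite addrAC subrr add0r.
have Ev : y + v - y = v by rewrite addrAC subrr add0r.
rewrite Eu in E1; rewrite Ev in E2.
rewrite -(subrK (p (x, y + v)) (p (x + u, y + v))) -addrA E1 E2.
rewrite (le_trans (ler_normD _ _))// !normrM.
have := h1 (c1, y + v); have := h2 (x, c2).
have := normr_ge0 u; have := normr_ge0 v; nra.
Qed.

(** First-order Taylor estimate with a remainder that is quadratic uniformly
    in the base point. *)
Lemma test_taylor p : test_function p -> exists2 K, 0 <= K & forall z h,
  `|p (z + h) - p z - (h.1 * 'D_e1 p z + h.2 * 'D_e2 p z)| <=
     K * (h.1 ^+ 2 + h.2 ^+ 2).
Proof.
move=> tp; have sp := test_smooth _ tp.
have [M1 M10 h1] := test_lipschitz _ (test_d1 _ tp).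
have [M2 M20 h2] := test_lipschitz _ (test_d2 _ tp).
exists (2 * M1 + 2 * M2); first by rewrite addr_ge0// mulr_ge0.
move=> [x y] [u v]; rewrite /= -[(x, y) + (u, v)]/(x + u, y + v).
have [c1 hc1 E1] := @mean_value R _ _ x (x + u)
   (fun t => (is_derive_e1 p t (y + v) _).1 (smooth_is_derive1 _ _ sp)).
have [c2 hc2 E2] := @mean_value R _ _ y (y + v)
   (fun t => (is_derive_e2 p x t _).1 (smooth_is_derive2 _ _ sp)).
have k1 := h1 (x, y) (c1 - x, v); have k2 := h2 (x, y) (0, c2 - y).
move: k1 k2 hc1 hc2 E1 E2.
rewrite -[(x, y) + _]/(x + (c1 - x), y + v) -[(x, y) + (0, _)]/(x + 0, y +
  (c2 - y)) /=.
rewrite !(addrC x (c1 - x)) !(addrC y (c2 - y)) !subrK addr0 normr0 add0r.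
have Eu : x + u - x = u by rewrite addrAC subrr add0r.
have Ev : y + v - y = v by rewrite addrAC subrr add0r.
rewrite Eu Ev.
move=> k1 k2 hc1 hc2 E1 E2.
set d1 := 'D_e1 p (x, y) in k1 *; set d2 := 'D_e2 p (x, y) in k2 *.
have -> : p (x + u, y + v) - p (x, y) - (u * d1 + v * d2) =
   u * ('D_e1 p (c1, y + v) - d1) + v * ('D_e2 p (x, c2) - d2).
  rewrite -[p (x + u, y + v)](subrK (p (x, y + v))) E1.
  by rewrite -[p (x, y + v)](subrK (p (x, y))) E2; ring.
rewrite (le_trans (ler_normD _ _))// !normrM.
rewrite -(real_normK (num_real u)) -(real_normK (num_real v)).
move: k1 k2 hc1 hc2; set a := `|u|; set b := `|v|.
set A := `|_ - d1|; set B := `|_ - d2|; set a' := `|c1 - x|;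
  set b' := `|c2 - y|.
move=> k1 k2 aa bb.
have a0 : 0 <= a by exact: normr_ge0.
have b0 : 0 <= b by exact: normr_ge0.
have : a * A <= M1 * (a * (a + b)).
  rewrite mulrCA ler_wpM2l// (le_trans k1)// ler_wpM2l// lerD2r//.
have : b * B <= M2 * (b * b).
  by rewrite mulrCA ler_wpM2l// (le_trans k2)// ler_wpM2l.
have : M1 * (a * (a + b)) <= M1 * (2 * (a ^+ 2 + b ^+ 2)).
  by rewrite ler_wpM2l//; have := sqr_ge0 (a - b); nra.
have : M2 * (b * b) <= M2 * (2 * (a ^+ 2 + b ^+ 2)).
  by rewrite ler_wpM2l//; nra.
lra.
Qed.

End TestCalculus.

(** * Lebesgue measure on the plane *)

Section PlaneMeasure.
Context {R : realType}.
Local Notation T1 := (measurableTypeR R).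
Local Notation T2 := (measurableTypeR R * measurableTypeR R)%type.
Local Notation mu := (@lebesgue_measure R).
Local Notation mu2 := (lebesgue2 R).
Implicit Types (h z : R * R).

Lemma lebesgue_measure_translate (a : R) (A : set T1) : measurable A ->
  pushforward mu (fun x : T1 => x + a : T1) A = mu A.
Proof.
have mt : measurable_fun setT (fun x : T1 => x + a : T1)
  by exact: measurable_funD.
move=> mA; apply/esym/lebesgue_measure_unique => //= _ [[u v]] _ <-.
rewrite /pushforward (_ : _ @^-1` _ = [set` `]u - a, v - a]]); last first.
  by apply/seteqP; split => x /=; rewrite !in_itv/= ltrBlDr lerBrDr.
rewrite !lebesgue_measure_itv/= !lte_fin ltrD2r.
by case: ifPn => // _; rewrite -!EFinB opprB addrA subrK.
Qed.

Lemma lebesgue2X (A B : set T1) : measurable A -> measurable B ->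
  (mu2 (A `*` B) = mu A * mu B)%E.
Proof. by move=> mA mB; exact: (product_measure1E mu mu). Qed.

Lemma lebesgue2_pushforward (f g : T1 -> T1) :
  measurable_fun setT f -> measurable_fun setT g ->
  (forall A, measurable A -> pushforward mu f A = mu A) ->
  (forall A, measurable A -> pushforward mu g A = mu A) ->
  forall A, measurable A -> pushforward mu2 (fun z : T2 => (f z.1, g z.2) : T2)
    A = mu2 A.
Proof.
move=> mf mg hf hg A mA.
have mfg : measurable_fun setT (fun z : T2 => (f z.1, g z.2) : T2).
  by apply: measurable_fun_pair => /=; apply: measurableT_comp.
apply/esym.
apply: (@product_measure_unique _ _ _ _ _ _ _
  (pushforward mu2 (fun z : T2 => (f z.1, g z.2) : T2))) => //.
move=> B C mB mC; rewrite /pushforward.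
have mfB : measurable (f @^-1` B) by rewrite -[X in measurable X]setTI;
  exact: mf.
have mgC : measurable (g @^-1` C) by rewrite -[X in measurable X]setTI;
  exact: mg.
transitivity (mu2 ((f @^-1` B) `*` (g @^-1` C))); first by [].
by rewrite lebesgue2X//; congr (_ * _)%E; [exact: hf|exact: hg].
Qed.

Lemma ge0_integral_pair (f g : T1 -> T1) (F : T2 -> \bar R) :
  measurable_fun setT f -> measurable_fun setT g ->
  (forall A, measurable A -> pushforward mu f A = mu A) ->
  (forall A, measurable A -> pushforward mu g A = mu A) ->
  measurable_fun setT F -> (forall z, (0 <= F z)%E) ->
  (\int[mu2]_z F (f z.1, g z.2) = \int[mu2]_z F z)%E.
Proof.
move=> mf mg hf hg mF F0.
have mfg : measurable_fun setT (fun z : T2 => (f z.1, g z.2) : T2).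
  by apply: measurable_fun_pair => /=; apply: measurableT_comp.
have := ge0_integral_pushforward mfg mu2 measurableT mF (fun z _ => F0 z).
rewrite preimage_setT => <-.
by apply: eq_measure_integral => A mA _; exact: lebesgue2_pushforward.
Qed.

Lemma ge0_integral_translate h (F : T2 -> \bar R) :
  measurable_fun setT F -> (forall z, (0 <= F z)%E) ->
  (\int[mu2]_z F ((z : R * R) + h)%R = \int[mu2]_z F z)%E.
Proof.
move=> mF F0.
apply: (@ge0_integral_pair (fun x => x + h.1) (fun x => x + h.2)) => //;
  try exact: lebesgue_measure_translate; exact: measurable_funD.
Qed.

Lemma ge0_integral_reflect (F : T2 -> \bar R) :
  measurable_fun setT F -> (forall z, (0 <= F z)%E) ->
  (\int[mu2]_z F (- z.1, z.2)%R = \int[mu2]_z F z)%E.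
Proof.
move=> mF F0; apply: (@ge0_integral_pair (fun x => - x) id) => //.
  exact: oppr_measurable.
exact: lebesgue_measureN.
Qed.

Lemma measurable_translate h : measurable_fun setT
  (fun z : T2 => (z : R * R) + h : T2).
Proof.
by apply: measurable_fun_pair => /=; apply: measurable_funD.
Qed.

Lemma sqint_translate (f : R * R -> R) h :
  sqint mu2 f -> sqint mu2 (fun z => f (z + h)).
Proof.
move=> [mf fint]; split.
  exact: (measurableT_comp mf (measurable_translate h)).
rewrite (ge0_integral_translate h (fun z => (f z ^+ 2)%:E))//.
- by apply/measurable_EFinP; exact: measurable_funX.
- by move=> z; rewrite lee_fin sqr_ge0.
Qed.

Lemma nrm2_translate (f : R * R -> R) h :
  sqint mu2 f -> nrm2 mu2 (fun z => f (z + h)) = nrm2 mu2 f.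
Proof.
move=> sf; apply: EFin_inj; rewrite !nrm2E//; last exact: sqint_translate.
rewrite (ge0_integral_translate h (fun z => (f z ^+ 2)%:E))//.
- by apply/measurable_EFinP; apply: measurable_funX; case: sf.
- by move=> z; rewrite lee_fin sqr_ge0.
Qed.

Lemma inner_translate (f g : R * R -> R) h : sqint mu2 f -> sqint mu2 g ->
  inner mu2 (fun z => f (z + h)) (fun z => g (z + h)) = inner mu2 f g.
Proof.
move=> sf sg.
have := nrm2_translate (fun z => f z + g z) h (sqintD _ _ sf sg).
rewrite nrm2D; try exact: sqint_translate.
by rewrite nrm2D// !nrm2_translate//; lra.
Qed.

Lemma measurable_box (N : R) : measurable (box N : set T2).
Proof. by apply: measurableX; exact: measurable_itv. Qed.

Lemma lebesgue2_box (N : R) : (mu2 (box N) < +oo)%E.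
Proof.
rewrite lebesgue2X; try exact: measurable_itv.
have iN : (mu (`[(- N)%R, N]%classic : set R) < +oo)%E.
  by rewrite lebesgue_measure_itv/=; case: ifP => _; rewrite ?ltry.
by rewrite lte_mul_pinfty// ge0_fin_numE.
Qed.

Lemma sqint_indic (A : set T2) : measurable A -> (mu2 A < +oo)%E ->
  sqint mu2 (\1_A : T2 -> R).
Proof.
move=> mA Afin; split; first exact: measurable_indic.
have E z : ((\1_A z : R) ^+ 2)%:E = (\1_A z)%:E.
  by rewrite indicE; case: (_ \in _); rewrite ?expr1n ?expr0n.
by under eq_integral => z _ do rewrite E; rewrite integral_indic// setIT.
Qed.

Lemma test_sqint (p : R * R -> R) : test_function p -> sqint mu2 p.
Proof.
move=> tp; have /testP[sp [N hN]] := tp; have [M M0 hM] := test_bounded _ tp.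
split; first exact: (continuous2_measurable _ (smooth_continuous _ sp)).
have mB := measurable_box N.
apply: (@le_lt_trans _ _ (\int[mu2]_(z in (box N : set T2)) (M ^+ 2)%:E)%E).
  rewrite [leRHS]integral_mkcond; apply: ge0_le_integral => //.
  - by move=> z _; rewrite lee_fin sqr_ge0.
  - apply/measurable_EFinP; apply: measurable_funX.
    exact: (continuous2_measurable _ (smooth_continuous _ sp)).
  - by apply/(measurable_restrictT _ mB).
  - move=> z _; rewrite patchE; case: ifPn => [_|nB].
      by rewrite lee_fin -(real_normK (num_real (p z))) lerXn2r// nnegrE.
    suff -> : p z = 0 by rewrite expr0n.
    by apply: contraNeq nB => /hN /boxP; rewrite inE.
rewrite integral_cst//= lte_mul_pinfty ?lee_fin ?sqr_ge0//.
exact: lebesgue2_box.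
Qed.

End PlaneMeasure.

Section PlaneSigmaFinite.
Context {R : realType}.
Local Notation T1 := (measurableTypeR R).
Local Notation T2 := (measurableTypeR R * measurableTypeR R)%type.
(** An alias of the plane measure that carries the sigma-finiteness which
    Tonelli's theorem asks for. *)
Definition plane_measure : set T2 -> \bar R := lebesgue2 R.

HB.instance Definition _ := Measure.copy plane_measure (lebesgue2 R).

Lemma plane_measure_sigma_finite : sigma_finite setT plane_measure.
Proof.
exists (fun n => box n%:R : set T2).
  apply/esym; rewrite -subTset => z _;
    exists (Num.truncn (Num.max `|z.1| `|z.2|)).+1 => //.
  by apply/boxP; split; rewrite ltW// (le_lt_trans _ (truncnS_gt _))// le_max
    lexx ?orbT.
by move=> n; split; [exact: measurable_box|exact: lebesgue2_box].
Qed.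

HB.instance Definition _ := Measure_isSigmaFinite.Build _ _ _ plane_measure
  plane_measure_sigma_finite.
End PlaneSigmaFinite.

(** * Density of the test functions *)

Section Rectangles.
Context {R : realType}.
Local Notation T1 := (measurableTypeR R).
Local Notation T2 := (measurableTypeR R * measurableTypeR R)%type.
Local Notation mu2 := (lebesgue2 R).

Definition rectangles : set (set T2) :=
  [set A `*` B | A in (@ocitv R) & B in (@ocitv R)].

Lemma rectanglesI : setI_closed rectangles.
Proof.
move=> _ _ [A oA [B oB <-]] [C oC [D oD <-]]; rewrite -setXI.
by exists (A `&` C); [exact: ocitvI|exists (B `&` D) => //; exact: ocitvI].
Qed.

Lemma bigcup_ocitv : \bigcup_n `](- n%:R)%R, n%:R]%classic = [set: R].
Proof.
rewrite -subTset => x _; exists (Num.truncn `|x|).+1 => //=.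
rewrite in_itv/=; have := truncnS_gt `|x|.
by rewrite ltr_norml => /andP[-> /ltW ->].
Qed.

(** The half-open rectangles generate the Borel sets: a strip is a countable
    union of rectangles, so that both projections are measurable for the
    sigma-algebra that they generate. *)
Lemma measurable_rectangles : @measurable _ T2 = <<s rectangles >>.
Proof.
rewrite measurable_prod_measurableType; apply/seteqP; split; last first.
  apply: smallest_sub; first exact: smallest_sigma_algebra.
  move=> _ [A oA [B oB <-]]; apply: sub_sigma_algebra.
  exists A; first exact: sub_sigma_algebra.
  by exists B => //; exact: sub_sigma_algebra.
apply: smallest_sub; first exact: smallest_sigma_algebra.
move=> _ [A mA [B mB <-]].
pose Tg : measurableType _ := g_sigma_algebraType rectangles.
have mfst : measurable_fun setT (fst : Tg -> T1).
  apply: (measurability (@ocitv R)) => // _ [C oC <-]; rewrite setTI.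
  have -> : fst @^-1` C = \bigcup_n (C `*` `](- n%:R)%R, n%:R]%classic : set
    Tg).
    by rewrite -setX_bigcupr bigcup_ocitv; apply/seteqP; split => // -[x y] [].
  apply: bigcupT_measurable => n; apply: sub_sigma_algebra.
  by exists C => //; exists `](- n%:R)%R, n%:R]%classic => //; exact: is_ocitv.
have msnd : measurable_fun setT (snd : Tg -> T1).
  apply: (measurability (@ocitv R)) => // _ [C oC <-]; rewrite setTI.
  have -> : snd @^-1` C = \bigcup_n (`](- n%:R)%R, n%:R]%classic `*` C : set
    Tg).
    by rewrite -setX_bigcupl bigcup_ocitv; apply/seteqP; split => // -[x y] [].
  apply: bigcupT_measurable => n; apply: sub_sigma_algebra.
  by exists `](- n%:R)%R, n%:R]%classic; [exact: is_ocitv|exists C].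
have -> : A `*` B = (fst @^-1` A) `&` (snd @^-1` B) by [].
suff : measurable ((fst @^-1` A) `&` (snd @^-1` B) : set Tg) by [].
apply: measurableI.
  by rewrite -[X in measurable X]setTI; exact: mfst.
by rewrite -[X in measurable X]setTI; exact: msnd.
Qed.

(** The half-open rectangles are closed under intersection, so that the sets on
    which the integral vanishes contain the sigma-algebra that they generate. *)
Lemma integral_rectangles_eq0 (w : T2 -> \bar R) : mu2.-integrable setT w ->
  (forall Q, rectangles Q -> \int[mu2]_(z in Q) w z = 0)%E ->
  (\int[mu2]_z w z = 0)%E -> ae_eq mu2 setT w (cst 0%E).
Proof.
move=> iw w0 wT; apply: integral_ae_eq => // E _ mE; rewrite integral0.
have sE : <<s rectangles >> E by rewrite -measurable_rectangles.
apply: (@dynkin_induction _ T2 rectangles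
  [set E | \int[mu2]_(z in E) w z = 0]%E) sE => //=.
- exact: measurable_rectangles.
- exact: rectanglesI.
- move=> S mS S0.
  have := @integral_setU _ _ _ mu2 S (~` S) w mS (measurableC mS).
  rewrite setUv wT S0 add0e => <- //; first exact: measurable_int iw.
  by apply/disj_setPCl.
- move=> F mF tF F0; rewrite integral_bigcup//.
    by rewrite eseries0.
  by apply: integrableS iw => //; exact: bigcupT_measurable.
Qed.

End Rectangles.

Section Bump.
Context {R : realType}.
Implicit Types (a b x t : R).

Lemma flat1E t : flat 1 t = if 0 < t then expR (- t^-1) else 0.
Proof. by rewrite /flat; case: ifP => // _; rewrite hornerC mul1r. Qed.

Lemma flat1_ge0 t : 0 <= flat 1 t.
Proof. by rewrite flat1E; case: ifP => // _; exact: expR_ge0. Qed.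

Lemma flat1_le1 t : flat 1 t <= 1.
Proof.
rewrite flat1E; case: ifP => [t0|_]; last exact: ler01.
by rewrite expR_le1 oppr_le0 invr_ge0 ltW.
Qed.

Lemma flat1_eq0 t : t <= 0 -> flat 1 t = 0.
Proof. by move=> t0; rewrite flat1E ltNge t0. Qed.

Lemma flat1_cvg1 (u : nat -> R) (c : R) : 0 < c ->
  (forall n, c * n.+1%:R <= u n) -> flat 1 (u n) @[n --> \oo] --> (1 : R).
Proof.
move=> c0 hu.
have un n : 0 < u n by rewrite (lt_le_trans _ (hu n))// mulr_gt0.
apply: (@squeeze_cvgr _ _ _ _ (fun n => 1 - c^-1 * harmonic n) (cst 1)).
- apply: nearW => n; rewrite flat1_le1 andbT flat1E un.
  apply: le_trans (expR_ge1Dx _).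
  by rewrite lerD2l lerN2 /harmonic/= -invfM lef_pV2// posrE// mulr_gt0.
- rewrite -[X in _ --> X]subr0 -(mulr0 c^-1); apply: cvgB; first exact: cvg_cst.
  by apply: cvgM; [exact: cvg_cst|exact: cvg_harmonic].
- exact: cvg_cst.
Qed.

(** The second factor is shifted so that it does not vanish at the end point
    [b] of the half-open interval. *)
Definition bump (n : nat) a b x : R := let N := n.+1%:R in
  flat 1 (N * x + - (N * a)) * flat 1 (- N ^+ 2 * x + (N ^+ 2 * b + N)).

Lemma bump_ge0 n a b x : 0 <= bump n a b x.
Proof. by rewrite mulr_ge0// flat1_ge0. Qed.

Lemma bump_le1 n a b x : bump n a b x <= 1.
Proof. by rewrite mulr_ile1 ?flat1_ge0 ?flat1_le1. Qed.

Lemma bump_supp n a b x : bump n a b x != 0 -> a <= x <= b + 1.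
Proof.
apply: contraNT; rewrite negb_and -!ltNge => /orP[xa|bx].
  rewrite /bump flat1_eq0 ?mul0r// -mulrN -mulrDr.
  by rewrite mulr_ge0_le0// subr_le0 ltW.
rewrite /bump mulrC flat1_eq0 ?mul0r//.
set N := n.+1%:R; have N1 : 1 <= N :> R by rewrite ler1n.
have : N * (x - b) >= N by rewrite ler_peMr//; lra.
have -> : - N ^+ 2 * x + (N ^+ 2 * b + N) = N * (1 - N * (x - b)) by ring.
by move=> h; rewrite mulr_ge0_le0//; lra.
Qed.

Lemma bump_cvg a b x : bump n a b x @[n --> \oo] --> (\1_`]a, b] x : R).
Proof.
rewrite indicE; case: (boolP (x \in _)).
  rewrite inE/= in_itv/= => /andP[ax xb].
  rewrite -[X in _ --> X]mulr1; apply: cvgM.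
    apply: (@flat1_cvg1 _ (x - a)); first by rewrite subr_gt0.
    by move=> n; rewrite mulrC -mulrN -mulrDr.
  apply: (@flat1_cvg1 _ 1) => // n; set N := n.+1%:R.
  have -> : - N ^+ 2 * x + (N ^+ 2 * b + N) = N ^+ 2 * (b - x) + N by ring.
  by rewrite mul1r lerDr mulr_ge0 ?sqr_ge0// subr_ge0.
rewrite notin_setE/= in_itv/= => /negP; rewrite negb_and -leNgt -ltNge => h.
apply: cvg_near_cst; case/orP: h => [xa|bx].
  apply: nearW => n; rewrite /bump flat1_eq0 ?mul0r// -mulrN -mulrDr.
  by rewrite mulr_ge0_le0// subr_le0.
have xb0 : 0 < x - b by rewrite subr_gt0.
exists (Num.truncn (x - b)^-1) => // n /= hn.
rewrite /bump mulrC flat1_eq0 ?mul0r//.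
set N := n.+1%:R.
have -> : - N ^+ 2 * x + (N ^+ 2 * b + N) = N * (1 - N * (x - b)) by ring.
rewrite mulr_ge0_le0// subr_le0 -ler_pdivrMr// div1r.
by rewrite (le_trans (ltW (truncnS_gt _)))// ler_nat.
Qed.

Definition bump2 (n : nat) (a b c d : R) (z : R * R) : R :=
  bump n a b z.1 * bump n c d z.2.

Lemma bump2_supp n a b c d z : bump2 n a b c d z != 0 ->
  a <= z.1 <= b + 1 /\ c <= z.2 <= d + 1.
Proof. by rewrite mulf_eq0 negb_or => /andP[/bump_supp ? /bump_supp]. Qed.

Lemma test_bump2 n a b c d : test_function (bump2 n a b c d).
Proof.
apply/testP; split.
  by apply: smooth_mul; apply: smooth_mul;
    [exact: smooth_flat_fst|exact: smooth_flat_fst|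
     exact: smooth_flat_snd|exact: smooth_flat_snd].
have nN (t : R) : - t <= `|t| by rewrite -normrN ler_norm.
exists (`|a| + `|b| + `|c| + `|d| + 1) => z /bump2_supp[].
have := ler_norm a; have := ler_norm b; have := ler_norm c; have := ler_norm d.
have := nN a; have := nN b.
have := nN c; have := nN d.
have := normr_ge0 a; have := normr_ge0 b; have := normr_ge0 c;
  have := normr_ge0 d.
by move=> ? ? ? ? ? ? ? ? ? ? ? ? /andP[? ?] /andP[? ?];
  split; rewrite ler_norml; apply/andP; split; lra.
Qed.

End Bump.

Section FundamentalLemma.
Context {R : realType}.
Local Notation T1 := (measurableTypeR R).
Local Notation T2 := (measurableTypeR R * measurableTypeR R)%type.
Local Notation mu2 := (lebesgue2 R).
Implicit Types (w : R * R -> R).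

(** The indicator of a half-open rectangle is a pointwise limit of bumps that
    are bounded by [1] and live on one fixed box. *)
Lemma orthogonal_test_rectangle w (a b c d : R) : sqint mu2 w ->
  (forall p, test_function p -> inner mu2 w p = 0) ->
  (\int[mu2]_z (w z * (\1_`]a, b] z.1 * \1_`]c, d] z.2))%:E = 0)%E.
Proof.
move=> sw w0.
pose N : R := `|a| + `|b| + `|c| + `|d| + 1.
pose F n (z : T2) := (w z * bump2 n a b c d z)%:E.
have sB : sqint mu2 (\1_(box N : set T2) : T2 -> R).
  by apply: sqint_indic; [exact: measurable_box|exact: lebesgue2_box].
have iF n : mu2.-integrable setT (F n).
  by apply: integrable_mul => //; apply: test_sqint; exact: test_bump2.
have F0 n : (\int[mu2]_z F n z = 0)%E.
  have := w0 _ (test_bump2 n a b c d); rewrite /inner /Rintegral => E.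
  apply: etrans (esym (fineK (integrable_fin_num measurableT (iF n)))) _.
  by rewrite [X in X%:E]E.
have iG : mu2.-integrable setT (fun z : T2 => (w z * \1_(box N : set T2) z)%:E).
  exact: integrable_mul.
have Fcvg (z : T2) : F n z @[n --> \oo] -->
    (w z * (\1_`]a, b] z.1 * \1_`]c, d] z.2))%:E.
  apply: cvg_EFin; first exact: nearW.
  apply: cvgM; first exact: cvg_cst.
  by apply: cvgM; exact: bump_cvg.
suff h : (\int[mu2]_z F n z)%E @[n --> \oo] -->
    (\int[mu2]_z (w z * (\1_`]a, b] z.1 * \1_`]c, d] z.2))%:E)%E.
  apply/esym; apply: (@cvg_unique _ _ (cst 0%E @ \oo)).
  - exact: ereal_hausdorff.
  - exact: cvg_cst.
  - by move: h; rewrite (_ : (fun n => _) = cst 0%E)//; apply/funext.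
apply: (@dominated_cvg _ _ _ mu2 setT measurableT F _ _
  (fun n => measurable_int _ (iF n)) (fun z _ => Fcvg z) _
    (integrable_abse iG)).
  by [].
move=> n z _.
rewrite /F /= lee_fin !(normrM (w z)) ler_wpM2l// indicE.
have [->|/bump2_supp[/andP[z1 z2] /andP[z3 z4]]] :=
  eqVneq (bump2 n a b c d z) 0.
  by rewrite normr0.
rewrite mem_set/=; last first.
  apply/boxP; rewrite /N.
  have nN (t : R) : - t <= `|t| by rewrite -normrN ler_norm.
  have := ler_norm b; have := ler_norm d; have := nN a; have := nN c.
  have := normr_ge0 a; have := normr_ge0 b.
  have := normr_ge0 c; have := normr_ge0 d.
  by move=> *; split; rewrite ler_norml; apply/andP; split; lra.
rewrite normr1 ger0_norm; last by rewrite mulr_ge0 ?bump_ge0.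
by rewrite mulr_ile1 ?bump_ge0 ?bump_le1.
Qed.

(** The fundamental lemma of the calculus of variations. *)
Lemma orthogonal_test_eq0 w : sqint mu2 w ->
  (forall p, test_function p -> inner mu2 w p = 0) -> nrm2 mu2 w = 0.
Proof.
move=> sw w0.
pose I (n : nat) : set R := `](- n%:R)%R, n%:R]%classic.
pose W n (z : T2) := (w z * (\1_(I n) z.1 * \1_(I n) z.2))%:E.
have mI n : measurable (I n : set T1) by exact: measurable_itv.
have IE n (z : T2) : \1_(I n) z.1 * \1_(I n) z.2 = \1_(I n `*` I n) z :> R.
  by rewrite !indicE in_setX; do 2 case: (_ \in _);
    rewrite ?mulr1 ?mulr0 ?mul0r.
have iW n : mu2.-integrable setT (W n).
  rewrite /W; under eq_fun do rewrite IE.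
  apply: integrable_mul => //; apply: sqint_indic.
    by apply: measurableX; exact: mI.
  apply: le_lt_trans (lebesgue2_box n%:R).
  apply: le_measure; rewrite ?inE; [|exact: measurable_box|].
    by apply: measurableX; exact: mI.
  move=> [x y] []; rewrite /I/= !in_itv/= => /andP[/ltW ? ?] /andP[/ltW ? ?].
  by apply/boxP; rewrite !ler_norml/=; split; apply/andP.
have aeW n : ae_eq mu2 setT (W n) (cst 0%E).
  apply: integral_rectangles_eq0 => //; last exact: orthogonal_test_rectangle.
  move=> _ [_ [[a b] _ <-] [_ [[c d] _ <-] <-]].
  rewrite integral_mkcond -[RHS](orthogonal_test_rectangle w
    (Num.max a (- n%:R)) (Num.min b n%:R)
    (Num.max c (- n%:R)) (Num.min d n%:R) sw w0).
  apply: eq_integral => -[x y] _.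
  rewrite patchE in_setX /W !indicE /I /=.
  rewrite !mem_setE !in_itv/= !gt_max !le_min.
  case: (a < x); case: (x <= b); case: (c < y); case: (y <= d);
    by rewrite /= ?andbF ?andbT /= ?(mulr0, mul0r, mulr1, mul1r).
have : \forall z \ae mu2, forall n, W n z = 0%E.
  by apply: ae_foralln => k; apply: filterS (aeW k) => z; exact.
move=> wae; apply: EFin_inj; rewrite nrm2E//.
rewrite (ae_eq_integral (cst 0%E)) ?integral0//.
  by apply/measurable_EFinP; apply: measurable_funX; case: sw.
apply: filterS wae => z Wz _ /=.
suff -> : w z = 0 by rewrite expr0n.
pose n := (Num.truncn (Num.max `|z.1| `|z.2|)).+1.
have := Wz n; rewrite /W !indicE !mem_set ?mulr1; first by case.
- rewrite /I/= in_itv/=.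
  have /(le_lt_trans _): Num.max `|z.1| `|z.2| < n%:R by exact: truncnS_gt.
  move=> /(_ `|z.2|); rewrite le_max lexx orbT => /(_ isT).
  by rewrite ltr_norml => /andP[-> /ltW].
- rewrite /I/= in_itv/=.
  have /(le_lt_trans _): Num.max `|z.1| `|z.2| < n%:R by exact: truncnS_gt.
  move=> /(_ `|z.1|); rewrite le_max lexx => /(_ isT).
  by rewrite ltr_norml => /andP[-> /ltW].
Qed.

(** Test functions are dense in [L^2], in the form in which density is used:
    a bound on the variational expression of the norm that is tested on smooth
    functions only is a bound on the norm. *)
Lemma nrm2_le_test w (M : R) : sqint mu2 w ->
  (forall p, test_function p -> 2 * inner mu2 w p - nrm2 mu2 p <= M) ->
  nrm2 mu2 w <= M.
Proof.
move=> sw hM.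
have [|||g [sg wg gM]] :=
  @riesz_subspace _ _ _ mu2 (@test_function R) (inner mu2 w) M test0 _ _ _ hM.
- by move=> p; exact: test_sqint.
- by move=> *; exact: test_lin.
- move=> u v p q tp tq; have sp := test_sqint _ tp; have sq := test_sqint _ tq.
  by rewrite innerDr ?innerZr//; exact: sqintZ.
have wg0 : nrm2 mu2 (fun z => w z - g z) = 0.
  apply: orthogonal_test_eq0 => [|p tp]; first exact: sqintB.
  by rewrite innerBl//; [rewrite wg// subrr|exact: test_sqint].
have := gM _ hM; suff -> : nrm2 mu2 g = nrm2 mu2 w by [].
have sd := sqintB _ _ sw sg.
have := nrm2D _ _ sd sg.
rewrite nrm2_eq0_inner// wg0 mulr0 !add0r => <-.
by congr nrm2; apply/funext => z; rewrite subrK.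
Qed.

End FundamentalLemma.

(** * Increments in mean square *)

Section Increments.
Context {R : realType}.
Local Notation mu2 := (lebesgue2 R).
Local Notation e1 := (e1 R).
Local Notation e2 := (e2 R).
Implicit Types (f g p : R * R -> R) (h z : R * R).

#[local] Opaque inner nrm2 sqint.

Definition sqlen h : R := h.1 ^+ 2 + h.2 ^+ 2.

Lemma sqlen_ge0 h : 0 <= sqlen h.
Proof. by rewrite addr_ge0// sqr_ge0. Qed.

(** The size of the increment of [f] for the shift [h], which is the function
    that is averaged against a Gaussian in the variance. *)
Definition incr f h : R := nrm2 mu2 (fun z => f (z + h) - f z).

Lemma sqint_incr f h : sqint mu2 f -> sqint mu2 (fun z => f (z + h) - f z).
Proof. by move=> sf; apply: sqintB => //; exact: sqint_translate. Qed.

Lemma inner_shift f g h : sqint mu2 f -> sqint mu2 g ->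
  inner mu2 (fun z => f (z + h)) g = inner mu2 f (fun z => g (z - h)).
Proof.
move=> sf sg; have := inner_translate f (fun z => g (z - h)) h sf
  (sqint_translate _ _ sg).
by move=> <-; congr inner; apply/funext => z; rewrite addrK.
Qed.

(** Pairing the Taylor estimate with [f] costs only the norm of [f], so that
    the same constant serves for all translates of [f]. *)
Lemma pairing_taylor p : test_function p -> exists2 C, 0 <= C &
  forall h f, sqlen h <= 1 -> sqint mu2 f ->
  `|inner mu2 f (fun z => p (z - h)) - inner mu2 f p +
     (h.1 * inner mu2 f (fun z => 'D_e1 p z) +
      h.2 * inner mu2 f (fun z => 'D_e2 p z))| <=
  C * (1 + nrm2 mu2 f) * sqlen h.
Proof.
move=> tp; have [K K0 hK] := test_taylor _ tp.
have [N1 hN1] : bsupp p by have /testP[] := tp.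
have [N2 hN2] : bsupp (fun z => 'D_e1 p z) by have /testP[] := test_d1 _ tp.
have [N3 hN3] : bsupp (fun z => 'D_e2 p z) by have /testP[] := test_d2 _ tp.
(* The margin [1] accounts for the shift by [h] in the unit disc. *)
pose N := Num.max N1 (Num.max N2 N3) + 1.
pose I : R * R -> R := \1_(box N).
have sI : sqint mu2 I.
  by apply: sqint_indic; [exact: measurable_box|exact: lebesgue2_box].
exists (K * (1 + nrm2 mu2 I)); first by rewrite mulr_ge0// addr_ge0// nrm2_ge0.
move=> h f h1 sf.
have sp := test_sqint _ tp; have sd1 := test_sqint _ (test_d1 _ tp).
have sd2 := test_sqint _ (test_d2 _ tp).
have sph := sqint_translate p (- h) sp.
have sr0 := sqintD _ _ (sqintZ h.1 _ sd1) (sqintZ h.2 _ sd2).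
have sr1 := sqintB _ _ sph sp.
pose r z := p (z - h) - p z + (h.1 * 'D_e1 p z + h.2 * 'D_e2 p z).
have sr : sqint mu2 r by exact: sqintD.
have <- : inner mu2 f r = inner mu2 f (fun z => p (z - h)) - inner mu2 f p +
     (h.1 * inner mu2 f (fun z => 'D_e1 p z) +
      h.2 * inner mu2 f (fun z => 'D_e2 p z)).
  rewrite /r (innerDr _ _ _ sr1 sr0 sf) (innerBr _ _ _ sph sp sf).
  rewrite (innerDr _ _ _ (sqintZ h.1 _ sd1) (sqintZ h.2 _ sd2) sf).
  by rewrite (innerZr _ _ _ sd1 sf) (innerZr _ _ _ sd2 sf).
have rI z : `|r z| <= K * sqlen h * `|I z|.
  have [zN|zN] := pselect (box N z).
    rewrite /I indicE mem_set// normr1 mulr1.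
    have := hK z (- h); rewrite /= !mulNr -opprD opprK => /le_trans; apply.
    by rewrite /sqlen !sqrrN.
  have z0 : r z = 0.
    have hh1 : `|h.1| <= 1.
      rewrite -(@expr_le1 _ 2)// real_normK ?num_real// (le_trans _ h1)//.
      by rewrite lerDl sqr_ge0.
    have hh2 : `|h.2| <= 1.
      rewrite -(@expr_le1 _ 2)// real_normK ?num_real// (le_trans _ h1)//.
      by rewrite lerDr sqr_ge0.
    have NE : Num.max N1 (Num.max N2 N3) = N - 1 by rewrite addrK.
    have [l1 l2 l3] : [/\ N1 <= N - 1, N2 <= N - 1 & N3 <= N - 1].
      by rewrite -NE !le_max !lexx !orbT.
    have zz (q : R * R -> R) N' : N' <= N - 1 -> (forall z, q z != 0 ->
        `|z.1| <= N' /\ `|z.2| <= N') -> q z = 0 /\ q (z - h) = 0.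
      move=> lN hq; split.
        apply/eqP; apply: contra_notT zN => /hq[q1 q2]; apply/boxP.
        by split; [move: q1|move: q2]; lra.
      apply/eqP; apply: contra_notT zN => /hq[/= q1 q2]; apply/boxP; split.
        by rewrite -(subrK h.1 z.1) (le_trans (ler_normD _ _))//; lra.
      by rewrite -(subrK h.2 z.2) (le_trans (ler_normD _ _))//; lra.
    have [p0 p1] := zz _ _ l1 hN1; have [d0 _] := zz _ _ l2 hN2.
    have [d0' _] := zz _ _ l3 hN3.
    by rewrite /r p0 p1 d0 d0'; ring.
  by rewrite z0 normr0 !mulr_ge0// sqlen_ge0.
have Ks0 : 0 <= K * sqlen h by rewrite mulr_ge0// sqlen_ge0.
apply: (le_trans (inner_bound _ _ _ (K * sqlen h) sf sr sI Ks0 rI)).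
have -> : K * (1 + nrm2 mu2 I) * (1 + nrm2 mu2 f) * sqlen h =
    K * sqlen h * ((1 + nrm2 mu2 I) * (1 + nrm2 mu2 f)) by ring.
rewrite ler_wpM2l//.
have f0 := nrm2_ge0 (mu := mu2) f; have I0 := nrm2_ge0 (mu := mu2) I.
by have := mulr_ge0 f0 I0; lra.
Qed.

Lemma telescope_le (a : nat -> R) (c : R) n :
  (forall k, (k < n)%N -> a k.+1 - a k <= c) -> a n - a 0%N <= n%:R * c.
Proof.
elim: n => [|n ih] h; first by rewrite subrr mul0r.
have := ih (fun k kn => h k (ltnW kn)); have := h n (ltnSn n).
by rewrite -natr1 mulrDl mul1r; lra.
Qed.

Lemma le_of_le_inv (x y c : R) :
  0 <= c -> (exists N, forall n, (N <= n)%N -> x <= y + c / n.+1%:R) -> x <= y.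
Proof.
move=> c0 [N h]; apply/ler_addgt0Pr => e e0.
pose n := maxn N (Num.truncn (c / e)).
apply: (le_trans (h n (leq_maxl _ _))); rewrite lerD2l ler_pdivrMr//.
rewrite mulrC -ler_pdivrMr// (le_trans (ltW (truncnS_gt _)))//.
by rewrite ler_nat ltnS leq_maxr.
Qed.

Let step_arith (x1 x2 i1 i2 u v c ak ak1 N M : R) : 0 < N ->
  2 * (x1 * i1 + x2 * i2) - v <= u ->
  ak1 - ak + (x1 / N * - i1 + x2 / N * - i2) <= c * (M / N ^+ 2) ->
  ak1 - ak <= (u + v) / 2 / N + c * M / N ^+ 2.
Proof.
move=> N0 huv; rewrite mulrA => h.
have : (x1 * i1 + x2 * i2) / N <= (u + v) / 2 / N.
  by rewrite ler_pM2r ?invr_gt0// ler_pdivlMr//; lra.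
by rewrite mulrDl; lra.
Qed.

(** The shift is cut into small steps.  Along each of them the pairing with a
    test function changes by the pairing of the gradient with a translate of
    that test function, up to a quadratic error, and these errors vanish in
    the limit.  Density turns the resulting bound into a bound on the norm. *)
Lemma incr_le_gradient f g1 g2 h : sqint mu2 f -> sqint mu2 g1 ->
  sqint mu2 g2 ->
  is_weak_partial e1 f g1 -> is_weak_partial e2 f g2 ->
  incr f h <= nrm2 mu2 (fun z => h.1 * g1 z + h.2 * g2 z).
Proof.
move=> sf s1 s2 w1 w2; pose G z := h.1 * g1 z + h.2 * g2 z.
have sG : sqint mu2 G by exact: (sqintD _ _ (sqintZ h.1 _ s1)
  (sqintZ h.2 _ s2)).
apply: nrm2_le_test; first exact: sqint_incr.
move=> p tp; have sp := test_sqint _ tp.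
have [C C0 hC] := pairing_taylor _ tp.
have f0 : 0 <= nrm2 mu2 f by exact: nrm2_ge0.
apply: (@le_of_le_inv _ _ (2 * (C * (1 + nrm2 mu2 f) * sqlen h))).
  by rewrite mulr_ge0// mulr_ge0 ?sqlen_ge0// mulr_ge0// addr_ge0.
(* The number [n] of steps is so large that each step lies in the unit disc. *)
exists (Num.truncn (sqlen h)) => m hm.
set n := m.+1; have n0 : 0 < n%:R :> R by rewrite ltr0n.
have n1 : 1 <= n%:R :> R by rewrite ler1n.
have hn : sqlen h <= n%:R by rewrite (le_trans (ltW (truncnS_gt _)))// ler_nat.
clearbody n.
pose e : R * R := (h.1 / n%:R, h.2 / n%:R).
have eE k : e *+ k = (h.1 / n%:R *+ k, h.2 / n%:R *+ k).
  elim: k => [|k ih]; first by rewrite !mulr0n.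
  by rewrite (mulrS e) ih (mulrS (h.1 / n%:R)) (mulrS (h.2 / n%:R)).
have en : e *+ n = h.
  rewrite eE -(mulr_natr (h.1 / n%:R)) -(mulr_natr (h.2 / n%:R)).
  by rewrite !divfK ?gt_eqF//; case: (h).
have sqe : sqlen e = sqlen h / n%:R ^+ 2
  by rewrite /sqlen /= !expr_div_n mulrDl.
have e1le : sqlen e <= 1.
  rewrite sqe ler_pdivrMr ?exprn_gt0// mul1r.
  by rewrite (le_trans hn)// -[leLHS]mulr1 expr2 ler_wpM2l// ltW.
pose psi k z := p (z - e *+ k).
have tpsi k : test_function (psi k) by exact: test_translate.
have spsi k := test_sqint _ (tpsi k).
have npsi k : nrm2 mu2 (psi k) = nrm2 mu2 p by exact: nrm2_translate.
pose a k := inner mu2 f (psi k).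
have step k : (k < n)%N ->
    a k.+1 - a k <= (nrm2 mu2 G + nrm2 mu2 p) / 2 / n%:R +
      C * (1 + nrm2 mu2 f) * sqlen h / n%:R ^+ 2.
  move=> _; have := hC e (fun z => f (z + e *+ k)) e1le
    (sqint_translate _ _ sf).
  rewrite nrm2_translate//.
  have T (q : R * R -> R) : sqint mu2 q ->
      inner mu2 (fun z => f (z + e *+ k)) q =
        inner mu2 f (fun z => q (z - e *+ k)).
    by move=> sq; exact: inner_shift.
  rewrite (T p sp) (T _ (sqint_translate p (- e) sp)).
  rewrite (T _ (test_sqint _ (test_d1 _ tp)))
    (T _ (test_sqint _ (test_d2 _ tp))).
  have -> : (fun z => p (z - e *+ k - e)) = psi k.+1.
    by apply/funext => z; rewrite /psi mulrSr opprD addrA.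
  have E1 : inner mu2 f (fun z => 'D_e1 p (z - e *+ k)) =
      - inner mu2 g1 (psi k).
    transitivity (inner mu2 f (fun z => 'D_e1 (psi k) z)); last exact: w1.
    by congr (inner _ _ _); apply/funext => z; rewrite /psi derive_translate.
  have E2 : inner mu2 f (fun z => 'D_e2 p (z - e *+ k)) =
      - inner mu2 g2 (psi k).
    transitivity (inner mu2 f (fun z => 'D_e2 (psi k) z)); last exact: w2.
    by congr (inner _ _ _); apply/funext => z; rewrite /psi derive_translate.
  rewrite E1 E2.
  rewrite -/(a k) -/(psi k) -/(a k) -/(a k.+1) sqe.
  have := inner_le _ _ sG (spsi k).
  rewrite /G (innerDl _ _ _ (sqintZ h.1 _ s1) (sqintZ h.2 _ s2) (spsi k)).
  rewrite (innerZl _ _ _ s1 (spsi k)) (innerZl _ _ _ s2 (spsi k)) npsi /= -/G.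
  move: (inner mu2 g1 (psi k)) (inner mu2 g2 (psi k)) => i1 i2.
  move: (nrm2 mu2 G) (nrm2 mu2 p) => u v hG.
  move: (a k) (a k.+1) => ak ak1 /ler_normlP[_]; exact: step_arith.
have := telescope_le a _ n step.
have -> : a n = inner mu2 (fun z => f (z + h)) p.
  by rewrite inner_shift// /a /psi en.
have -> : a 0%N = inner mu2 f p.
  by rewrite /a /psi; congr inner; apply/funext => z; rewrite mulr0n subr0.
rewrite (innerBl _ _ _ (sqint_translate f h sf) sf sp).
rewrite mulrDr [n%:R * _]mulrC divfK ?gt_eqF//.
have -> : n%:R * (C * (1 + nrm2 mu2 f) * sqlen h / n%:R ^+ 2) =
  C * (1 + nrm2 mu2 f) * sqlen h / n%:R by field; rewrite gt_eqF.
by rewrite -mulrA; lra.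
Qed.

Let mul_ge_of_norm_le (x X Y c : R) :
  `|X + Y| <= c -> - `|x| * c - x * Y <= x * X.
Proof.
move=> XY; have : `|x * (X + Y)| <= `|x| * c by rewrite normrM ler_wpM2l.
by rewrite ler_norml => /andP[]; lra.
Qed.

Let incr_ge_arith (x y ax ay X1 X2 b11 b12 b21 b22 n1 n2 P c1 c2 : R) :
  0 <= c2 * ax -> 0 <= c1 * ay ->
  - ay * c2 - y * (x * b21 + y * b22) <= y * X2 ->
  - ax * c1 - x * (x * b11 + y * b12) <= x * X1 ->
  (- 2 * b11 - n1) * x ^+ 2 + 2 * (- b12 - b21 - P) * x * y +
  (- 2 * b22 - n2) * y ^+ 2 - 2 * (c1 + c2) * (ax + ay) <=
  2 * (x * X1 + y * X2) - (x ^+ 2 * n1 + 2 * x * y * P + y ^+ 2 * n2).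
Proof. rewrite !expr2; lra. Qed.

(** Testing the increment against [h.1 * p1 + h.2 * p2] bounds it from below
    by a quadratic form whose trace is minus twice the pairing of [f] with the
    divergence of [(p1, p2)], less the square norm of this field. *)
Lemma incr_ge f p1 p2 : sqint mu2 f -> test_function p1 -> test_function p2 ->
  exists C B : R, [/\ 0 <= C & forall h, sqlen h <= 1 ->
   (- 2 * inner mu2 f (fun z => 'D_e1 p1 z) - nrm2 mu2 p1) * h.1 ^+ 2 +
   2 * B * h.1 * h.2 +
   (- 2 * inner mu2 f (fun z => 'D_e2 p2 z) - nrm2 mu2 p2) * h.2 ^+ 2
   - C * sqlen h * (`|h.1| + `|h.2|) <= incr f h].
Proof.
move=> sf t1 t2; have s1 := test_sqint _ t1; have s2 := test_sqint _ t2.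
have [C1 C10 h1] := pairing_taylor _ t1;
  have [C2 C20 h2] := pairing_taylor _ t2.
have f0 : 0 <= nrm2 mu2 f by exact: nrm2_ge0.
exists (2 * (C1 + C2) * (1 + nrm2 mu2 f)).
(* The coefficient of the cross term, which the Gaussian average removes. *)
exists (- inner mu2 f (fun z => 'D_e2 p1 z) - inner mu2 f (fun z => 'D_e1 p2 z)
  - inner mu2 p1 p2).
split; first by rewrite !mulr_ge0// addr_ge0.
move=> h hh; have sh := sqint_incr f h sf.
have sP := sqintD _ _ (sqintZ h.1 _ s1) (sqintZ h.2 _ s2).
have := inner_le _ _ sh sP; rewrite -/(incr f h).
rewrite nrm2_lin// innerDr ?(innerZr _ _ _ s1 sh) ?(innerZr _ _ _ s2 sh)//;
  try exact: sqintZ.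
rewrite !(innerBl _ _ _ (sqint_translate f h sf) sf) // !inner_shift//.
have := h1 h f hh sf; have := h2 h f hh sf.
set X1 := _ - inner mu2 f p1; set X2 := _ - inner mu2 f p2.
set b11 := inner mu2 f (fun z => 'D_e1 p1 z);
  set b12 := inner mu2 f (fun z => 'D_e2 p1 z).
set b21 := inner mu2 f (fun z => 'D_e1 p2 z);
  set b22 := inner mu2 f (fun z => 'D_e2 p2 z).
move=> k2 k1 H; apply: le_trans H.
have := mul_ge_of_norm_le h.1 _ _ _ k1; have := mul_ge_of_norm_le h.2 _ _ _ k2.
set c1 := C1 * _ * _; set c2 := C2 * _ * _.
have c10 : 0 <= c1 by rewrite mulr_ge0 ?sqlen_ge0// mulr_ge0// addr_ge0.
have c20 : 0 <= c2 by rewrite mulr_ge0 ?sqlen_ge0// mulr_ge0// addr_ge0.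
have -> : 2 * (C1 + C2) * (1 + nrm2 mu2 f) * sqlen h * (`|h.1| + `|h.2|) =
  2 * (c1 + c2) * (`|h.1| + `|h.2|) by rewrite /c1 /c2; ring.
move: (mulr_ge0 c20 (normr_ge0 h.1)) (mulr_ge0 c10 (normr_ge0 h.2)) =>
  {c10 c20}.
exact: incr_ge_arith.
Qed.

End Increments.

(** * Gaussian averages *)

Section Gaussian1.
Context {R : realType}.
Local Notation mu := (@lebesgue_measure R).
Implicit Types (L x : R).

Definition gauss L x : R := expR (- L * x ^+ 2).

Lemma gauss_ge0 L x : 0 <= gauss L x. Proof. exact: expR_ge0. Qed.

Lemma measurable_gauss L : measurable_fun setT (gauss L).
Proof.
apply: measurableT_comp => //; apply: measurable_funM => //.
Qed.

Lemma gauss_mass L : 0 < L ->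
  (\int[mu]_x (gauss L x)%:E = (Num.sqrt (pi / L))%:E)%E.
Proof.
move=> L0; pose s : R := Num.sqrt (2 * L)^-1.
have L2 : 0 < (2 * L)^-1 by rewrite invr_gt0 mulr_gt0.
have s0 : s != 0 by rewrite gt_eqF// sqrtr_gt0.
have s2 : s ^+ 2 = (2 * L)^-1 by rewrite sqr_sqrtr// ltW.
have pk : normal_peak s = (Num.sqrt (pi / L))^-1.
  rewrite /normal_peak s2; congr (Num.sqrt _)^-1.
  by rewrite -mulr_natr; field; rewrite gt_eqF.
have q0 : 0 < Num.sqrt (pi / L) by rewrite sqrtr_gt0 divr_gt0// pi_gt0.
have E x : (gauss L x)%:E = ((Num.sqrt (pi / L))%:E * (normal_pdf 0 s x)%:E)%E.
  rewrite normal_pdfE// pk -EFinM mulrA divff ?gt_eqF// mul1r;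
    congr (expR _)%:E.
  by rewrite subr0 s2 -mulr_natr; field; rewrite gt_eqF.
under eq_integral => x _ do rewrite E.
rewrite integralZl//=; last exact: integrable_normal_pdf.
by rewrite integral_normal_pdf mule1.
Qed.

(** The second moment is minus the derivative of the mass with respect to [L];
    the convexity of the exponential squeezes it between the difference
    quotients on both sides. *)
Lemma gauss_moment2 L : 0 < L ->
  (\int[mu]_x (x ^+ 2 * gauss L x)%:E = (Num.sqrt (pi / L) / (2 * L))%:E)%E.
Proof.
move=> L0.
have [a [a0 La]] : exists a : R, 0 < a /\ L = a ^+ 2.
  by exists (Num.sqrt L); rewrite sqrtr_gt0 sqr_sqrtr// ltW.
pose c : R := Num.sqrt pi; have c0 : 0 < c by rewrite sqrtr_gt0 pi_gt0.
(* Square intensities avoid square roots in the difference quotients. *)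
have mass b : 0 < b -> (\int[mu]_x (gauss (b ^+ 2) x)%:E = (c / b)%:E)%E.
  move=> b0; rewrite gauss_mass ?exprn_gt0//; congr (_%:E).
  by rewrite sqrtrM ?pi_ge0// sqrtrV ?exprn_ge0 ?(ltW b0)// sqrtr_sqr
    ger0_norm// ltW.
set I := (\int[mu]_x _)%E.
have m2 : measurable_fun setT (fun x => (x ^+ 2 * gauss L x)%:E).
  apply/measurable_EFinP; apply: measurable_funM; last exact: measurable_gauss.
  exact: measurable_funX.
have mg K : measurable_fun setT (fun x => (gauss K x)%:E).
  by apply/measurable_EFinP; exact: measurable_gauss.
have I0 : (0 <= I)%E.
  by apply: integral_ge0 => x _; rewrite lee_fin mulr_ge0 ?sqr_ge0 ?gauss_ge0.
have lin (d : R) : 0 <= d ->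
   (\int[mu]_x (gauss L x + d * (x ^+ 2 * gauss L x))%:E = (c / a)%:E +
     d%:E * I)%E.
  move=> d0; under eq_integral => x _ do rewrite EFinD EFinM.
  rewrite ge0_integralD//; first last.
  - by apply: emeasurable_funM.
  - by move=> x _; rewrite mule_ge0// lee_fin mulr_ge0 ?sqr_ge0 ?gauss_ge0.
  - exact: mg.
  - by move=> x _; rewrite lee_fin gauss_ge0.
  rewrite ge0_integralZl//; last by move=> x _;
    rewrite lee_fin mulr_ge0 ?sqr_ge0 ?gauss_ge0.
  by rewrite -(mass a a0) -La.
have up b : 0 < b -> b < a -> ((c / a)%:E + (a ^+ 2 - b ^+ 2)%:E * I <=
  (c / b)%:E)%E.
  move=> b0 ba; have d0 : 0 <= a ^+ 2 - b ^+ 2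
    by rewrite subr_ge0 lerXn2r ?nnegrE ?ltW.
  rewrite -lin// -mass//; apply: ge0_le_integral => //.
  - by move=> x _; rewrite lee_fin addr_ge0 ?gauss_ge0// mulr_ge0// mulr_ge0
      ?sqr_ge0 ?gauss_ge0.
  - apply/measurable_EFinP; apply: measurable_funD;
      first exact: measurable_gauss.
    by apply: measurable_funM => //; exact/measurable_EFinP.
  - exact: mg.
  - move=> x _; rewrite lee_fin /gauss.
    have -> : - b ^+ 2 * x ^+ 2 = (a ^+ 2 - b ^+ 2) * x ^+ 2 + - L * x ^+ 2.
      by rewrite La; ring.
    rewrite expRD mulrA -{1}[expR (- L * _)]mul1r -mulrDl ler_wpM2r ?expR_ge0//.
    exact: expR_ge1Dx.
have down b : a < b -> ((c / a)%:E <= (c / b)%:E + (b ^+ 2 - a ^+ 2)%:E * I)%E.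
  move=> ab; have b0 : 0 < b by exact: lt_trans ab.
  have d0 : 0 <= b ^+ 2 - L by rewrite La subr_ge0 lerXn2r ?nnegrE ?ltW.
  rewrite -[X in (X <= _)%E]mass// -La -mass// -ge0_integralZl//; last first.
    by move=> x _; rewrite lee_fin mulr_ge0 ?sqr_ge0 ?gauss_ge0.
  rewrite -ge0_integralD//; first last.
  - by apply: emeasurable_funM.
  - by move=> x _; rewrite mule_ge0// lee_fin mulr_ge0 ?sqr_ge0 ?gauss_ge0.
  - exact: mg.
  - by move=> x _; rewrite lee_fin gauss_ge0.
  apply: ge0_le_integral => //.
  - by move=> x _; rewrite lee_fin gauss_ge0.
  - exact: mg.
  - by apply: emeasurable_funD; [exact: mg|exact: emeasurable_funM].
  - move=> x _; rewrite -EFinM -EFinD lee_fin /gauss.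
    have -> : - b ^+ 2 * x ^+ 2 = - ((b ^+ 2 - L) * x ^+ 2) + - L * x ^+ 2
      by ring.
    have hE : 0 <=
        expR (- ((b ^+ 2 - L) * x ^+ 2)) - (1 - (b ^+ 2 - L) * x ^+ 2).
      by rewrite subr_ge0; exact: expR_ge1Dx.
    have := mulr_ge0 hE (expR_ge0 (- L * x ^+ 2)); rewrite expRD.
    by move: (expR _) (expR _) => u v; rewrite mulrA; lra.
have Ifin : I \is a fin_num.
  have a20 : 0 < a / 2 by rewrite divr_gt0.
  have ha : a / 2 < a by rewrite ltr_pdivrMr// ltr_pMr// ltr1n.
  have d0 : 0 < a ^+ 2 - (a / 2) ^+ 2
    by rewrite subr_gt0 ltrXn2r// ?nnegrE// ltW.
  rewrite ge0_fin_numE//; have := up (a / 2) a20 ha.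
  suff h J : ((c / a)%:E + (a ^+ 2 - (a / 2) ^+ 2)%:E * J <= (c / (a / 2))%:E ->
    0 <= J -> J < +oo)%E by move=> /h; exact.
  case: J => [r _ _| |//]; first exact: ltry.
  by rewrite gt0_muley ?lte_fin// addey// leye_eq.
move: up down I0; rewrite -(fineK Ifin); set y := fine I => up down y0.
rewrite La sqrtrM ?pi_ge0// sqrtrV ?exprn_ge0 ?(ltW a0)// sqrtr_sqr
  (ger0_norm (ltW a0)).
rewrite -/c; congr (_%:E); rewrite lee_fin in y0.
have up' b : 0 < b -> b < a -> y * (a * b * (a + b)) <= c.
  move=> b0 ba; have := up b b0 ba; rewrite -EFinM -EFinD lee_fin.
  have an : a != 0 by rewrite gt_eqF. have bn : b != 0 by rewrite gt_eqF.
  have dab : 0 < a - b by rewrite subr_gt0.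
  rewrite -subr_ge0.
  have -> : c / b - (c / a + (a ^+ 2 - b ^+ 2) * y) =
    (c - y * (a * b * (a + b))) * ((a - b) / (a * b)) by field; rewrite an bn.
  by rewrite pmulr_lge0 ?divr_gt0 ?mulr_gt0// subr_ge0.
have down' b : a < b -> c <= y * (a * b * (a + b)).
  move=> ab; have := down b ab; rewrite -EFinM -EFinD lee_fin.
  have b0 : 0 < b by exact: lt_trans ab.
  have an : a != 0 by rewrite gt_eqF. have bn : b != 0 by rewrite gt_eqF.
  have dab : 0 < b - a by rewrite subr_gt0.
  rewrite -subr_ge0.
  have -> : c / b + (b ^+ 2 - a ^+ 2) * y - c / a =
    (y * (a * b * (a + b)) - c) * ((b - a) / (a * b)) by field; rewrite an bn.
  by rewrite pmulr_lge0 ?divr_gt0 ?mulr_gt0// subr_ge0.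
suff -> : c = 2 * a ^+ 3 * y by field; rewrite gt_eqF.
apply/eqP; rewrite eq_le; apply/andP; split.
- apply/ler_addgt0Pr => e e0.
  pose K := y * a * (3 * a + 1) + 1.
  have K0 : 0 < K by rewrite ltr_wpDl// !mulr_ge0// ?ltW//; lra.
  pose t := Num.min 1 (e / K).
  have t0 : 0 < t by rewrite lt_min ltr01 divr_gt0.
  have t1 : t <= 1 by rewrite ge_min lexx.
  have te : t * K <= e by rewrite -ler_pdivlMr// ge_min lexx orbT.
  have := down' (a + t); rewrite ltrDl => /(_ t0) /le_trans; apply.
  have -> : y * (a * (a + t) * (a + (a + t))) = 2 * a ^+ 3 * y +
    y * a * (3 * a + t) * t.
    by ring.
  rewrite lerD2l (le_trans _ te)// mulrC ler_wpM2l ?ltW// /K.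
  have : y * a * (3 * a + t) <= y * a * (3 * a + 1).
    by rewrite ler_wpM2l ?mulr_ge0 ?(ltW a0)// lerD2l.
  by lra.
- apply/ler_addgt0Pr => e e0.
  pose K := 3 * y * a ^+ 2 + 1.
  have K0 : 0 < K by rewrite ltr_wpDl// !mulr_ge0// ?exprn_ge0 ?(ltW a0).
  pose t := Num.min (a / 2) (e / K).
  have t0 : 0 < t by rewrite lt_min !divr_gt0.
  have t1 : t <= a / 2 by rewrite ge_min lexx.
  have te : t * K <= e by rewrite -ler_pdivlMr// ge_min lexx orbT.
  have := up' (a - t); rewrite subr_gt0 ltrBlDr ltrDl.
  move=> /(_ (le_lt_trans t1 _) t0);
    rewrite ltr_pdivrMr// ltr_pMr// ltr1n => /(_ isT) h.
  have -> : 2 * a ^+ 3 * y = y * (a * (a - t) * (a + (a - t))) +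
    y * a * (3 * a - t) * t.
    by ring.
  apply: lerD => //; rewrite (le_trans _ te)// mulrC ler_wpM2l ?(ltW t0)// /K.
  have : 0 <= y * a * t by rewrite !mulr_ge0 ?(ltW a0) ?(ltW t0).
  by rewrite expr2; lra.
Qed.

End Gaussian1.

Section Gaussian2.
Context {R : realType}.
Local Notation T1 := (measurableTypeR R).
Local Notation T2 := (measurableTypeR R * measurableTypeR R)%type.
Local Notation mu := (@lebesgue_measure R).
Local Notation mu2 := (lebesgue2 R).
Implicit Types (h z : R * R).

Lemma ge0_integral_tensor (u v : R -> R) :
  measurable_fun setT u -> measurable_fun setT v ->
  (forall x, 0 <= u x) -> (forall x, 0 <= v x) ->
  (\int[mu2]_z (u z.1 * v z.2)%:E =
   (\int[mu]_x (u x)%:E) * (\int[mu]_x (v x)%:E))%E.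
Proof.
move=> mu_ mv u0 v0.
have muv : measurable_fun setT (fun z : T2 => (u z.1 * v z.2)%:E).
  apply/measurable_EFinP; apply: measurable_funM.
    exact: (measurableT_comp mu_ (@measurable_fst _ _ T1 T1)).
  exact: (measurableT_comp mv (@measurable_snd _ _ T1 T1)).
have := @fubini_tonelli1 _ _ T1 T1 R mu mu (fun z : T2 => (u z.1 * v z.2)%:E)
  muv.
have uv0 (z : T2) : (0 <= (u z.1 * v z.2)%:E)%E by rewrite lee_fin mulr_ge0.
move=> /(_ uv0) E; apply: (etrans E); rewrite /fubini_F /=.
have V0 : (0 <= \int[mu]_x (v x)%:E)%E by apply: integral_ge0 => x _;
  rewrite lee_fin.
rewrite -ge0_integralZr//; last 2 first.
  - by apply/measurable_EFinP.
  - by move=> x _; rewrite lee_fin.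
apply: eq_integral => x _; under eq_integral => y _ do rewrite EFinM.
rewrite ge0_integralZl//; first by apply/measurable_EFinP.
  by move=> y _; rewrite lee_fin.
by rewrite lee_fin.
Qed.

Definition gauss2 (L : R) h : R := gauss L h.1 * gauss L h.2.

Lemma gauss2E L h : gauss2 L h = expR (- L * sqlen h).
Proof. by rewrite /gauss2 /gauss -expRD /sqlen mulrDr. Qed.

Lemma gauss2_ge0 L h : 0 <= gauss2 L h.
Proof. by rewrite gauss2E expR_ge0. Qed.

Lemma measurable_gauss2 L : measurable_fun setT (gauss2 L : T2 -> R).
Proof.
apply: measurable_funM.
  exact: (measurableT_comp (measurable_gauss L) (@measurable_fst _ _ T1 T1)).
exact: (measurableT_comp (measurable_gauss L) (@measurable_snd _ _ T1 T1)).
Qed.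

Lemma measurable_sqlen : measurable_fun setT (sqlen : T2 -> R).
Proof.
apply: measurable_funD; apply: measurable_funX.
  exact: (@measurable_fst _ _ T1 T1).
exact: (@measurable_snd _ _ T1 T1).
Qed.

Definition second_moment (L : R) : R := pi / (2 * L ^+ 2).

Lemma gauss2_moment (L a e : R) : 0 < L -> 0 <= a -> 0 <= e ->
  (\int[mu2]_h (gauss2 L h * (a * h.1 ^+ 2 + e * h.2 ^+ 2))%:E =
   ((a + e) * second_moment L)%:E)%E.
Proof.
move=> L0 a0 e0.
have mx : measurable_fun setT (fun x : R => x ^+ 2 * gauss L x).
  by apply: measurable_funM; [exact: measurable_funX|exact: measurable_gauss].
have x0 (x : R) : 0 <= x ^+ 2 * gauss L x
  by rewrite mulr_ge0 ?sqr_ge0 ?gauss_ge0.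
have mE : (Num.sqrt (pi / L) / (2 * L)) * Num.sqrt (pi / L) = second_moment L.
  rewrite mulrAC -expr2 sqr_sqrtr ?divr_ge0 ?pi_ge0 ?ltW// /second_moment.
  by field; rewrite gt_eqF.
have I1 : (\int[mu2]_z (z.1 ^+ 2 * gauss L z.1 * gauss L z.2)%:E =
  (second_moment L)%:E)%E.
  rewrite (ge0_integral_tensor (fun x => x ^+ 2 * gauss L x) (gauss L))//.
  - by rewrite gauss_moment2// gauss_mass// -EFinM mE.
  - exact: measurable_gauss.
  - exact: gauss_ge0.
have I2 : (\int[mu2]_z (gauss L z.1 * (z.2 ^+ 2 * gauss L z.2))%:E =
  (second_moment L)%:E)%E.
  rewrite (ge0_integral_tensor (gauss L) (fun x => x ^+ 2 * gauss L x))//.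
  - by rewrite gauss_moment2// gauss_mass// -EFinM mulrC mE.
  - exact: measurable_gauss.
  - exact: gauss_ge0.
have m1 : measurable_fun setT (fun z : T2 =>
  (z.1 ^+ 2 * gauss L z.1 * gauss L z.2)%:E).
  apply/measurable_EFinP; apply: measurable_funM.
    exact: (measurableT_comp mx (@measurable_fst _ _ T1 T1)).
  exact: (measurableT_comp (measurable_gauss L) (@measurable_snd _ _ T1 T1)).
have m3 : measurable_fun setT (fun z : T2 =>
  (gauss L z.1 * (z.2 ^+ 2 * gauss L z.2))%:E).
  apply/measurable_EFinP; apply: measurable_funM.
    exact: (measurableT_comp (measurable_gauss L) (@measurable_fst _ _ T1 T1)).
  exact: (measurableT_comp mx (@measurable_snd _ _ T1 T1)).
have p1 (z : T2) : (0 <= (z.1 ^+ 2 * gauss L z.1 * gauss L z.2)%:E)%E.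
  by rewrite lee_fin mulr_ge0 ?gauss_ge0.
have p2 (z : T2) : (0 <= (gauss L z.1 * (z.2 ^+ 2 * gauss L z.2))%:E)%E.
  by rewrite lee_fin mulr_ge0 ?gauss_ge0.
transitivity (\int[mu2]_z (a%:E * (z.1 ^+ 2 * gauss L z.1 * gauss L z.2)%:E +
    e%:E * (gauss L z.1 * (z.2 ^+ 2 * gauss L z.2))%:E))%E.
  by apply: eq_integral => z _; rewrite -!EFinM -EFinD /gauss2; congr (_%:E);
    ring.
rewrite ge0_integralD//.
- by rewrite !ge0_integralZl// I1 I2 -!EFinM -EFinD mulrDl.
- by move=> z _; rewrite mule_ge0.
- by apply: emeasurable_funM.
- by move=> z _; rewrite mule_ge0.
- by apply: emeasurable_funM.
Qed.

(** Trading half of the exponent against the polynomial factor leaves a Gaussian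
    of intensity [L / 2]; only the decay of order [L ^- 3] matters, because the
    second moment is of order [L ^- 2]. *)
Lemma gauss2_moment4 (L : R) : 0 < L ->
  (\int[mu2]_h (gauss2 L h * sqlen h ^+ 2)%:E <= (16 * pi / L ^+ 3)%:E)%E.
Proof.
move=> L0; have L20 : 0 < L / 2 by rewrite divr_gt0.
have mg : measurable_fun setT (fun h : T2 => (gauss2 (L / 2) h)%:E).
  by apply/measurable_EFinP; exact: measurable_gauss2.
have <- : (\int[mu2]_h ((8 / L ^+ 2)%:E * (gauss2 (L / 2) h)%:E) =
    (16 * pi / L ^+ 3)%:E)%E.
  rewrite ge0_integralZl//; last 2 first.
  - by move=> z _; rewrite lee_fin gauss2_ge0.
  - by rewrite lee_fin divr_ge0// exprn_ge0// ltW.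
  rewrite (ge0_integral_tensor (gauss (L / 2)) (gauss (L / 2)))//;
    try exact: measurable_gauss; try exact: gauss_ge0.
  rewrite gauss_mass// -!EFinM -expr2 sqr_sqrtr ?divr_ge0 ?pi_ge0 ?ltW//.
  by congr (_%:E); field; rewrite gt_eqF.
apply: ge0_le_integral => //.
- by move=> z _; rewrite lee_fin mulr_ge0 ?gauss2_ge0 ?sqr_ge0.
- apply/measurable_EFinP; apply: measurable_funM;
    first exact: measurable_gauss2.
  by apply: measurable_funX; exact: measurable_sqlen.
- exact: emeasurable_funM.
move=> z _; rewrite -EFinM lee_fin !gauss2E.
set s := sqlen z; have s0 : 0 <= s by exact: sqlen_ge0.
have y0 : 0 <= L * s / 2 by rewrite divr_ge0// mulr_ge0// ltW.
have := expR_ge1Dxn 1 y0; have -> : - L * s = - (L * s / 2) - L * s / 2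
  by field.
have -> : - (L / 2) * s = - (L * s / 2) by field.
rewrite expRD !expRN; set E := expR _ => hE.
have E0 : 0 < E by exact: expR_gt0.
rewrite -subr_ge0.
have -> : 8 / L ^+ 2 / E - E^-1 / E * s ^+ 2 =
   8 / L ^+ 2 / E ^+ 2 * (E - (L * s / 2) ^+ 2 / 2) by field; rewrite !gt_eqF.
rewrite mulr_ge0 ?divr_ge0 ?exprn_ge0 ?(ltW E0) ?(ltW L0)//.
by move: hE; rewrite (_ : 2`!%:R = 2 :> R)//; lra.
Qed.

Lemma measurable_sig : measurable_fun setT (fun h : T2 => (- h.1, h.2) : T2).
Proof.
have mo : measurable_fun setT (fun x : T1 => - x : T1)
  by exact: oppr_measurable.
apply: measurable_fun_pair; last exact: (@measurable_snd _ _ T1 T1).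
exact: (measurableT_comp mo (@measurable_fst _ _ T1 T1)).
Qed.

Lemma measurable_quad (a e : R) :
  measurable_fun setT (fun h : T2 => a * h.1 ^+ 2 + e * h.2 ^+ 2).
Proof.
apply: measurable_funD; apply: measurable_funM => //; apply: measurable_funX.
  exact: (@measurable_fst _ _ T1 T1).
exact: (@measurable_snd _ _ T1 T1).
Qed.

(** Averaging over the reflection [(x, y) |-> (- x, y)] replaces a function by
    its even part; for a quadratic form this removes the cross term. *)
Lemma integral_gauss2_sym (L : R) (D : R * R -> R) :
  measurable_fun setT (D : T2 -> R) -> (forall h, 0 <= D h) ->
  (\int[mu2]_h (gauss2 L h * (D h + D (- h.1, h.2)))%:E =
   2%:E * \int[mu2]_h (gauss2 L h * D h)%:E)%E.
Proof.
move=> mD D0; have mgD : measurable_fun setT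
  (fun h : T2 => (gauss2 L h * D h)%:E).
  by apply/measurable_EFinP; apply: measurable_funM => //;
    exact: measurable_gauss2.
have gD0 (h : T2) : (0 <= (gauss2 L h * D h)%:E)%E
  by rewrite lee_fin mulr_ge0 ?gauss2_ge0.
have R1 := ge0_integral_reflect _ mgD gD0.
have msig := measurable_sig.
rewrite mule_natl mule2n -{2}R1 -ge0_integralD//.
  apply: eq_integral => h _; rewrite mulrDr EFinD; congr (_ + (_ * _)%:E)%E.
  by rewrite /gauss2 /gauss /= sqrrN.
exact: (measurableT_comp mgD msig).
Qed.

(** A Gaussian average sees only the trace of a quadratic form. *)
Lemma gauss2_average_le (L A B E : R) (D : R * R -> R) : 0 < L ->
  measurable_fun setT (D : T2 -> R) -> (forall h, 0 <= D h) ->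
  (forall h, D h <= A * h.1 ^+ 2 + 2 * B * h.1 * h.2 + E * h.2 ^+ 2) ->
  (\int[mu2]_h (gauss2 L h * D h)%:E <= ((A + E) * second_moment L)%:E)%E.
Proof.
move=> L0 mD D0 hD.
have A0 : 0 <= A.
  by have := le_trans (D0 _) (hD (1, 0));
    rewrite /= expr1n expr0n !mulr0 mulr1 !addr0.
have E0 : 0 <= E.
  by have := le_trans (D0 _) (hD (0, 1));
    rewrite /= expr1n expr0n !mulr0 !mul0r mulr1 !add0r.
rewrite -(@lee_pmul2l _ 2%:E)// -integral_gauss2_sym// -EFinM.
have -> : 2 * ((A + E) * second_moment L) = (2 * A + 2 * E) * second_moment L
  by ring.
rewrite -gauss2_moment ?mulr_ge0//.
apply: ge0_le_integral => //.
- by move=> h _; rewrite lee_fin mulr_ge0 ?gauss2_ge0// addr_ge0.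
- apply/measurable_EFinP; apply: measurable_funM;
    first exact: measurable_gauss2.
  apply: measurable_funD => //; apply: (measurableT_comp mD);
    exact: measurable_sig.
- apply/measurable_EFinP; apply: measurable_funM;
    first exact: measurable_gauss2.
  exact: measurable_quad.
- move=> h _; rewrite lee_fin ler_wpM2l ?gauss2_ge0//.
  by have := hD h; have := hD (- h.1, h.2); rewrite /= sqrrN; lra.
Qed.

Let quadratic_form_le (A B E : R) h :
  A * h.1 ^+ 2 + 2 * B * h.1 * h.2 + E * h.2 ^+ 2 <=
    (`|A| + `|B| + `|E|) * sqlen h.
Proof.
move: h => [x y]; rewrite /sqlen /=.
have hA : A * x ^+ 2 <= `|A| * x ^+ 2 by rewrite ler_wpM2r ?sqr_ge0// ler_norm.
have hE : E * y ^+ 2 <= `|E| * y ^+ 2 by rewrite ler_wpM2r ?sqr_ge0// ler_norm.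
have hB : 2 * B * x * y <= `|B| * (x ^+ 2 + y ^+ 2).
  have [B0|B0] := leP 0 B.
    have := mulr_ge0 B0 (sqr_ge0 (x - y)); rewrite ger0_norm//; lra.
  have := mulr_ge0 (normr_ge0 B) (sqr_ge0 (x + y)); rewrite ltr0_norm//; lra.
have := mulr_ge0 (normr_ge0 A) (sqr_ge0 y);
  have := mulr_ge0 (normr_ge0 E) (sqr_ge0 x).
lra.
Qed.

Let cubic_le (C d : R) h : 0 <= C -> 0 < d ->
  C * sqlen h * (`|h.1| + `|h.2|) <= d * sqlen h +
    2 * C ^+ 2 / d * sqlen h ^+ 2.
Proof.
move=> C0 d0; have s0 := sqlen_ge0 h.
set t := `|h.1| + `|h.2|.
have t2 : t ^+ 2 <= 2 * sqlen h.
  rewrite /t /sqlen -(real_normK (num_real h.1)) -(real_normK (num_real h.2)).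
  by have := sqr_ge0 (`|h.1| - `|h.2|); lra.
have h1 : C * t <= d + (C * t) ^+ 2 / d.
  rewrite -lerBlDl ler_pdivlMr//.
  by have := sqr_ge0 (C * t - d); have := sqr_ge0 (C * t + d); rewrite !expr2;
    lra.
have h2 : (C * t) ^+ 2 / d <= 2 * C ^+ 2 / d * sqlen h.
  have -> : (C * t) ^+ 2 / d = C ^+ 2 / d * t ^+ 2 by ring.
  have -> : 2 * C ^+ 2 / d * sqlen h = C ^+ 2 / d * (2 * sqlen h) by ring.
  by rewrite ler_wpM2l// divr_ge0 ?sqr_ge0// ltW.
have := ler_wpM2r s0 (le_trans h1 (lerD (lexx d) h2)).
by rewrite expr2; lra.
Qed.

Let quad_sym_arith (A B E d K M Dp Dm : R) h :
  A * h.1 ^+ 2 + 2 * B * h.1 * h.2 + E * h.2 ^+ 2 <=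
    Dp + d * sqlen h + M * sqlen h ^+ 2 ->
  A * (- h.1) ^+ 2 + 2 * B * (- h.1) * h.2 + E * h.2 ^+ 2 <=
    Dm + d * sqlen (- h.1, h.2) + M * sqlen (- h.1, h.2) ^+ 2 ->
  2 * (A + K) * h.1 ^+ 2 + 2 * (E + K) * h.2 ^+ 2 <=
  Dp + Dm + (2 * (d + K) * h.1 ^+ 2 + 2 * (d + K) * h.2 ^+ 2) +
    2 * M * sqlen h ^+ 2.
Proof.
have -> : sqlen (- h.1, h.2) = sqlen h by rewrite /sqlen /= sqrrN.
move: (sqlen h ^+ 2) => q; rewrite sqrrN /sqlen; lra.
Qed.

(** The quadratic form bounds [D] from below only on the unit disc and up to a
    cubic error.  Both defects are absorbed by [d * sqlen h], which contributes
    little to the trace, and by [M * sqlen h ^+ 2], whose average is of lower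
    order. *)
Lemma gauss2_average_ge (A B E C : R) (D : R * R -> R) :
  measurable_fun setT (D : T2 -> R) -> (forall h, 0 <= D h) -> 0 <= C ->
  (forall h, sqlen h <= 1 -> A * h.1 ^+ 2 + 2 * B * h.1 * h.2 + E * h.2 ^+ 2
     - C * sqlen h * (`|h.1| + `|h.2|) <= D h) ->
  forall e, 0 < e -> exists2 L0, 0 < L0 & forall L, L0 <= L ->
  (((A + E - e) * second_moment L)%:E <= \int[mu2]_h (gauss2 L h * D h)%:E)%E.
Proof.
move=> mD D0 C0 hD e e0.
(* One half of [e] pays for the trace [2 * d] of the quadratic part of the error
   and the other half for the average of its quartic part. *)
pose d := e / 4; have d0 : 0 < d by rewrite divr_gt0.
have [K [K0 KA KE KB]] : exists K, [/\ 0 <= K, - K <= A, - K <= E &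
    forall h, A * h.1 ^+ 2 + 2 * B * h.1 * h.2 + E * h.2 ^+ 2 <= K * sqlen h].
  exists (`|A| + `|B| + `|E|); split; last by move=> h;
    exact: quadratic_form_le.
  - by rewrite !addr_ge0.
  - by have := lerNnormlW (lexx `|A|); have := normr_ge0 B; have := normr_ge0 E;
      lra.
  - by have := lerNnormlW (lexx `|E|); have := normr_ge0 B; have := normr_ge0 A;
      lra.
have [M M0 hM] : exists2 M, 0 <= M & forall h,
   A * h.1 ^+ 2 + 2 * B * h.1 * h.2 + E * h.2 ^+ 2 <=
     D h + d * sqlen h + M * sqlen h ^+ 2.
  exists (2 * C ^+ 2 / d + K).
    by rewrite addr_ge0// divr_ge0 ?(ltW d0)// mulr_ge0// sqr_ge0.
  move=> h; have s0 := sqlen_ge0 h.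
  have c0 : 0 <= 2 * C ^+ 2 / d
    by rewrite divr_ge0 ?(ltW d0)// mulr_ge0// sqr_ge0.
  have [s1|s1] := leP (sqlen h) 1.
    have := hD h s1; have := cubic_le C d h C0 d0.
    have : 0 <= K * sqlen h ^+ 2 by rewrite mulr_ge0 ?sqr_ge0.
    by rewrite mulrDl; lra.
  apply: (le_trans (KB h)); rewrite mulrDl.
  have : K * sqlen h <= K * sqlen h ^+ 2.
    by rewrite ler_wpM2l// expr2 ler_peMl// ltW.
  have : 0 <= 2 * C ^+ 2 / d * sqlen h ^+ 2 by rewrite mulr_ge0 ?sqr_ge0.
  have := mulr_ge0 (ltW d0) s0; have := D0 h; lra.
exists (16 * M / d + 1); first by rewrite ltr_wpDl// divr_ge0 ?(ltW d0)//
  mulr_ge0.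
move=> L hL.
have L0 : 0 < L.
  by apply: lt_le_trans hL; rewrite ltr_wpDl// divr_ge0 ?(ltW d0)// mulr_ge0.
set W := (\int[mu2]_h _)%E.
have msq : measurable_fun setT (sqlen : T2 -> R) by exact: measurable_sqlen.
have mg := measurable_gauss2 L.
(* Adding [K] to both diagonal entries makes all integrands nonnegative. *)
have key : (((2 * (A + K) + 2 * (E + K)) * second_moment L)%:E <=
    2%:E * W + ((2 * (d + K) + 2 * (d + K)) * second_moment L)%:E +
    (2 * M)%:E * (16 * pi / L ^+ 3)%:E)%E.
  have dK0 : 0 <= 2 * (d + K) by rewrite mulr_ge0// addr_ge0// ltW.
  rewrite -gauss2_moment ?mulr_ge0//; try by rewrite -lerBlDr sub0r.
  apply: (@le_trans _ _ (2%:E * W +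
    ((2 * (d + K) + 2 * (d + K)) * second_moment L)%:E +
    (2 * M)%:E * \int[mu2]_h (gauss2 L h * sqlen h ^+ 2)%:E)%E); last first.
    by rewrite leeD2l// lee_wpmul2l ?lee_fin ?mulr_ge0// gauss2_moment4.
  rewrite -(gauss2_moment _ _ _ L0 dK0 dK0) /W -integral_gauss2_sym//.
  have q0 (h : T2) : (0 <= (gauss2 L h * sqlen h ^+ 2)%:E)%E.
    by rewrite lee_fin mulr_ge0 ?gauss2_ge0 ?sqr_ge0.
  have mq : measurable_fun setT (fun h : T2 => (gauss2 L h * sqlen h ^+ 2)%:E).
    by apply/measurable_EFinP; apply: measurable_funM => //;
      exact: measurable_funX.
  have s0 (h : T2) : (0 <= (gauss2 L h * (D h + D (- h.1, h.2)))%:E)%E.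
    by rewrite lee_fin mulr_ge0 ?gauss2_ge0// addr_ge0.
  have ms : measurable_fun setT
    (fun h : T2 => (gauss2 L h * (D h + D (- h.1, h.2)))%:E).
    apply/measurable_EFinP; apply: measurable_funM => //.
    by apply: measurable_funD => //; apply: (measurableT_comp mD);
      exact: measurable_sig.
  have r0 (h : T2) : (0 <= (gauss2 L h *
      (2 * (d + K) * h.1 ^+ 2 + 2 * (d + K) * h.2 ^+ 2))%:E)%E.
    by rewrite lee_fin mulr_ge0 ?gauss2_ge0// addr_ge0// mulr_ge0 ?sqr_ge0.
  have mr : measurable_fun setT (fun h : T2 => (gauss2 L h *
      (2 * (d + K) * h.1 ^+ 2 + 2 * (d + K) * h.2 ^+ 2))%:E).
    by apply/measurable_EFinP; apply: measurable_funM => //;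
      exact: measurable_quad.
  rewrite -ge0_integralZl//; last by rewrite lee_fin mulr_ge0.
  rewrite -ge0_integralD// -ge0_integralD//; first last.
  - by apply: emeasurable_funM.
  - by move=> h _; rewrite mule_ge0// lee_fin mulr_ge0.
  - by apply: emeasurable_funD.
  - by move=> h _; rewrite adde_ge0.
  apply: ge0_le_integral => //.
  - move=> h _; rewrite lee_fin mulr_ge0 ?gauss2_ge0// addr_ge0// mulr_ge0
      ?sqr_ge0//.
      by rewrite mulr_ge0// -lerBlDr sub0r.
    by rewrite mulr_ge0// -lerBlDr sub0r.
  - by apply/measurable_EFinP; apply: measurable_funM => //;
      exact: measurable_quad.
  - by apply: emeasurable_funD;
      [apply: emeasurable_funD|apply: emeasurable_funM].
  - move=> h _; rewrite -EFinM -!EFinD lee_fin (mulrCA (2 * M)).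
    rewrite -!(mulrDr (gauss2 L h)) ler_wpM2l ?gauss2_ge0//.
    have h1 := hM h; have h2 := hM (- h.1, h.2); rewrite /= in h2.
    exact: quad_sym_arith h1 h2.
have fin : (16 * pi / L ^+ 3) * M <= d * (2 * second_moment L).
  have -> : d * (2 * second_moment L) = d * (pi / L ^+ 2)
    by rewrite /second_moment; field; rewrite gt_eqF.
  have -> : 16 * pi / L ^+ 3 * M = (16 * M / L) * (pi / L ^+ 2).
    by field; rewrite gt_eqF.
  rewrite ler_pM2r ?divr_gt0 ?pi_gt0 ?exprn_gt0//.
  rewrite ler_pdivrMr// [d * L]mulrC -ler_pdivrMr// (le_trans _ hL)// lerDl.
  exact: ler01.
have W0 : (0 <= W)%E.
  by apply: integral_ge0 => h _; rewrite lee_fin mulr_ge0 ?gauss2_ge0.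
case: W W0 key => [r r0 | _ _|//]; last by rewrite leey.
rewrite -!EFinM -!EFinD !lee_fin.
have -> : e = 4 * d by rewrite /d; field.
move: fin; move: (second_moment L) (16 * pi / L ^+ 3) => m q; lra.
Qed.

End Gaussian2.

(** * The variance as a Gaussian average *)

Section GinibreKernel.
Context {R : realType}.
Import complex.
Local Open Scope complex_scope.
Implicit Types (z w : R * R) (L : R).

Lemma cabsM (x y : R[i]) : cabs (x * y) = cabs x * cabs y.
Proof. exact: ComplexField.Normc.normcM. Qed.

Lemma cabs_real (x : R) : cabs x%:C = `|x|.
Proof. by rewrite /cabs /= expr0n /= addr0 sqrtr_sqr. Qed.

Lemma cabs_expC (x : R[i]) : cabs (expC x) = expR (Re x).
Proof.
rewrite /expC cabsM cabs_real ger0_norm ?expR_ge0//.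
by rewrite /cabs /= cos2Dsin2 sqrtr1 mulr1.
Qed.

Lemma cabs_toC_sqr z : cabs (toC z) ^+ 2 = sqlen z.
Proof. by rewrite /cabs /= sqr_sqrtr// addr_ge0 ?sqr_ge0. Qed.

(** The real part of the exponent is [- L / 2 * sqlen (z - w)], by polarization;
    hence the modulus of the kernel is invariant under translation. *)
Lemma cabs_ginibre_kernel L z w :
  cabs (ginibre_kernel L z w) ^+ 2 = (L / pi) ^+ 2 * gauss2 L (z - w).
Proof.
rewrite /ginibre_kernel cabsM cabs_real cabs_expC exprMn real_normK ?num_real//.
rewrite gauss2E !cabs_toC_sqr; congr (_ * _); rewrite -expRM_natl; congr expR.
by rewrite /sqlen /=; field.
Qed.

End GinibreKernel.

Section VarianceFormula.
Context {R : realType}.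
Local Notation T1 := (measurableTypeR R).
Local Notation T2 := (measurableTypeR R * measurableTypeR R)%type.
Local Notation mu2 := (lebesgue2 R).
Implicit Types (f : R * R -> R) (L : R).

Lemma measurable_increment f : measurable_fun setT (f : T2 -> R) ->
  measurable_fun setT (fun z : T2 * T2 =>
    (f ((z.1 : R * R) + z.2) - f z.1) ^+ 2).
Proof.
move=> mf; apply: measurable_funX; apply: measurable_funB; last first.
  exact: (measurableT_comp mf (@measurable_fst _ _ T2 T2)).
apply: (measurableT_comp (f := f : T2 -> R) mf).
have m1 := @measurable_fst _ _ T2 T2; have m2 := @measurable_snd _ _ T2 T2.
apply: measurable_fun_pair => /=; apply: measurable_funD.
- exact: (measurableT_comp (@measurable_fst _ _ T1 T1) m1).
- exact: (measurableT_comp (@measurable_fst _ _ T1 T1) m2).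
- exact: (measurableT_comp (@measurable_snd _ _ T1 T1) m1).
- exact: (measurableT_comp (@measurable_snd _ _ T1 T1) m2).
Qed.

Lemma incrE f h : sqint mu2 f ->
  (incr f h)%:E = (\int[mu2]_z ((f (z + h) - f z) ^+ 2)%:E)%E.
Proof. by move=> sf; rewrite /incr nrm2E//; exact: sqint_incr. Qed.

Lemma incr_ge0 f h : 0 <= incr f h.
Proof. exact: nrm2_ge0. Qed.

Lemma measurable_incr f : sqint mu2 f -> measurable_fun setT (incr f : T2 -> R).
Proof.
move=> sf; apply/measurable_EFinP.
rewrite (_ : EFin \o _ = (fun h => \int[mu2]_z ((f (z + h) - f z) ^+ 2)%:E)%E);
  last first.
  by apply/funext => h /=; rewrite incrE.
have mF : measurable_fun setT
    (fun z : T2 * T2 => ((f ((z.1 : R * R) + z.2) - f z.1) ^+ 2)%:E).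
  by apply/measurable_EFinP; apply: measurable_increment; case: sf.
have F0 (z : T2 * T2) : (0 <= ((f ((z.1 : R * R) + z.2) - f z.1) ^+ 2)%:E)%E.
  by rewrite lee_fin sqr_ge0.
exact: (@measurable_fun_fubini_tonelli_G _ _ T2 T2 R plane_measure _ mF F0).
Qed.

(** Substituting [y = x + h] in the inner integral and exchanging the integrals,
    all terms being nonnegative. *)
Lemma ginibre_variance_average f L : sqint mu2 f ->
  (ginibre_variance L f =
   (2^-1 * (L / pi) ^+ 2)%:E * \int[mu2]_h (gauss2 L h * incr f h)%:E)%E.
Proof.
move=> sf; have mf : measurable_fun setT (f : T2 -> R) by case: sf.
pose c : R := (L / pi) ^+ 2; have c0 : 0 <= c by exact: sqr_ge0.
pose F (z : T2 * T2) :=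
  (c * (gauss2 L z.2 * (f ((z.1 : R * R) + z.2) - f z.1) ^+ 2))%:E.
have mF : measurable_fun setT F.
  apply/measurable_EFinP; apply: measurable_funM => //; apply: measurable_funM.
    exact: (measurableT_comp (measurable_gauss2 L) (@measurable_snd _ _ T2 T2)).
  exact: measurable_increment.
have F0 z : (0 <= F z)%E.
  by rewrite lee_fin mulr_ge0// mulr_ge0 ?gauss2_ge0 ?sqr_ge0.
have inner_int (x : R * R) :
    (\int[mu2]_y (`|f x - f y| ^+ 2 * cabs (ginibre_kernel L x y) ^+ 2)%:E =
     \int[mu2]_h F (x, h))%E.
  pose G (y : T2) := (c * (gauss2 L (x - y) * (f x - f y) ^+ 2))%:E.
  transitivity (\int[mu2]_y G y)%E.
    apply: eq_integral => y _;
      rewrite cabs_ginibre_kernel real_normK ?num_real//.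
    by rewrite /G -/c; congr (_%:E); ring.
  have mG : measurable_fun setT G.
    apply/measurable_EFinP; apply: measurable_funM => //;
      apply: measurable_funM.
      apply: (measurableT_comp (measurable_gauss2 L)).
      by apply: measurable_fun_pair => /=; apply: measurable_funB.
    by apply: measurable_funX; apply: measurable_funB.
  have G0 y : (0 <= G y)%E.
    by rewrite lee_fin mulr_ge0// mulr_ge0 ?gauss2_ge0 ?sqr_ge0.
  rewrite -(ge0_integral_translate x G mG G0); apply: eq_integral => y _.
  rewrite /G /F /=; have -> : x - ((y : R * R) + x) = - y
    by rewrite opprD addrCA subrr addr0.
  have -> : gauss2 L (- y) = gauss2 L y by rewrite !gauss2E /sqlen /= !sqrrN.
  by rewrite [(y : R * R) + x]addrC -[in LHS]sqrrN opprB.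
rewrite /ginibre_variance /dpp_variance EFinM -muleA; congr (_ * _)%E.
transitivity (\int[mu2]_x \int[mu2]_h F (x, h))%E.
  by apply: eq_integral => x _; exact: inner_int.
apply: (etrans (@fubini_tonelli _ _ T2 T2 R plane_measure plane_measure F mF
  F0)).
have mgi : measurable_fun setT (fun h : T2 => (gauss2 L h * incr f h)%:E).
  apply/measurable_EFinP; apply: measurable_funM;
    first exact: measurable_gauss2.
  exact: measurable_incr.
rewrite -ge0_integralZl//; last by move=> h _;
  rewrite lee_fin mulr_ge0 ?gauss2_ge0 ?incr_ge0.
apply: eq_integral => h _.
have mi : measurable_fun setT (fun z : T2 => ((f (z + h) - f z) ^+ 2)%:E).
  by apply/measurable_EFinP; apply: measurable_funX; case: (sqint_incr f h sf).
have cg0 : 0 <= c * gauss2 L h by rewrite mulr_ge0 ?gauss2_ge0.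
rewrite (EFinM (gauss2 L h)) incrE// muleA -EFinM -ge0_integralZl//.
  by apply: eq_integral => x _; rewrite /F /= -EFinM mulrA.
by move=> x _; rewrite lee_fin sqr_ge0.
Qed.

Let variance_constant L : 0 < L ->
  2^-1 * (L / pi) ^+ 2 * second_moment L = 1 / (4 * pi).
Proof.
have p0 : (pi : R) != 0 by rewrite gt_eqF ?pi_gt0.
rewrite /second_moment; move: (pi : R) p0 => p p0 /lt0r_neq0 L0; field;
  by rewrite L0 p0.
Qed.

(** For a function with a weak gradient the limit is an upper bound for every
    intensity. *)
Lemma ginibre_variance_le f g1 g2 L : sqint mu2 f -> sqint mu2 g1 ->
  sqint mu2 g2 ->
  is_weak_partial (e1 R) f g1 -> is_weak_partial (e2 R) f g2 -> 0 < L ->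
  (ginibre_variance L f <= (1 / (4 * pi) * (nrm2 mu2 g1 + nrm2 mu2 g2))%:E)%E.
Proof.
move=> sf s1 s2 w1 w2 L0.
rewrite ginibre_variance_average// -(variance_constant _ L0).
have : 0 < 2^-1 * (L / pi) ^+ 2
  by rewrite mulr_gt0 ?exprn_gt0 ?divr_gt0 ?pi_gt0.
move: (2^-1 * (L / pi) ^+ 2) => k k0.
rewrite -(mulrA k) (EFinM k) lee_pmul2l ?lte_fin// [second_moment L * _]mulrC.
apply: (gauss2_average_le L _ (inner mu2 g1 g2)) => //.
- exact: measurable_incr.
- exact: incr_ge0.
- move=> h; apply: (le_trans (incr_le_gradient f g1 g2 h sf s1 s2 w1 w2)).
  by rewrite nrm2_lin//; lra.
Qed.

(** By duality, the supremum of this functional over the test functions [p] is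
    the square norm of the distributional derivative of [f] in the first
    direction, or infinite if that derivative is not square integrable. *)
Definition functional1 f (p : R * R -> R) : R :=
  - 2 * inner mu2 f (fun z => 'D_(e1 R) p z) - nrm2 mu2 p.

Definition functional2 f (p : R * R -> R) : R :=
  - 2 * inner mu2 f (fun z => 'D_(e2 R) p z) - nrm2 mu2 p.

Lemma ginibre_variance_ge f p1 p2 (e : R) :
  sqint mu2 f -> test_function p1 -> test_function p2 -> 0 < e ->
  exists2 L0, 0 < L0 & forall L, L0 <= L ->
  ((1 / (4 * pi) *
     (functional1 f p1 + functional2 f p2 - e))%:E <=
   ginibre_variance L f)%E.
Proof.
move=> sf t1 t2 e0; have [C [B [C0 hC]]] := incr_ge f p1 p2 sf t1 t2.
have [L0 L00 hL] := gauss2_average_ge _ _ _ _ (incr f) (measurable_incr f sf)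
  (incr_ge0 f) C0 hC e e0.
exists L0 => // L L0L; have Lp : 0 < L by exact: lt_le_trans L0L.
rewrite ginibre_variance_average// -(variance_constant _ Lp).
have : 0 < 2^-1 * (L / pi) ^+ 2
  by rewrite mulr_gt0 ?exprn_gt0 ?divr_gt0 ?pi_gt0.
move: (2^-1 * (L / pi) ^+ 2) => k k0.
rewrite -(mulrA k) (EFinM k) lee_pmul2l ?lte_fin// [second_moment L * _]mulrC.
exact: hL.
Qed.

End VarianceFormula.

(** * The weak gradient and the limit *)

Section WeakGradient.
Context {R : realType}.
Local Notation mu2 := (lebesgue2 R).
Local Notation e1 := (e1 R).
Local Notation e2 := (e2 R).
Implicit Types (f g p : R * R -> R).

Lemma L2P f : L2 f <-> sqint mu2 f.
Proof. exact: sqintP. Qed.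

(** The distributional derivative is a linear form on the test functions, and
    the hypothesis is the bound under which it has a representing function. *)
Lemma weak_partial_riesz (v : R * R) f (M : R) : sqint mu2 f ->
  (forall p, test_function p -> test_function (fun z => 'D_v p z)) ->
  (forall p z, test_function p -> derivable p z v) ->
  (forall p, test_function p ->
     - 2 * inner mu2 f (fun z => 'D_v p z) - nrm2 mu2 p <= M) ->
  exists2 g, sqint mu2 g & is_weak_partial v f g.
Proof.
move=> sf tv dv hM.
pose l p := - inner mu2 f (fun z => 'D_v p z).
have lin a b p q : test_function p -> test_function q ->
    l (fun z => a * p z + b * q z) = a * l p + b * l q.
  move=> tp tq; rewrite /l.
  have -> : (fun z => 'D_v (fun z => a * p z + b * q z) z) =
      (fun z => a * 'D_v p z + b * 'D_v q z).
    apply/funext => z; apply: derive_val.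
    have dp := derivableP (dv p z tp); have dq := derivableP (dv q z tq).
    exact: (is_deriveD (is_deriveZ a dp) (is_deriveZ b dq)).
  have sp := test_sqint _ (tv _ tp); have sq := test_sqint _ (tv _ tq).
  rewrite (innerDr _ _ _ (sqintZ a _ sp) (sqintZ b _ sq) sf).
  by rewrite (innerZr _ _ _ sp sf) (innerZr _ _ _ sq sf) opprD !mulrN.
have [|||g [sg gl _]] :=
  @riesz_subspace _ _ _ mu2 (@test_function R) l M test0 _ _ lin _.
- by move=> p; exact: test_sqint.
- by move=> *; exact: test_lin.
- by move=> p tp; rewrite /l mulrN -mulNr; exact: hM.
by exists g => // p tp; rewrite -[RHS]/(- inner mu2 g p) -gl// /l opprK.
Qed.

Lemma derivable_test1 p z : test_function p -> derivable p z e1.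
Proof. by move=> /test_smooth sp; case: (smooth_is_derive1 p z sp). Qed.

Lemma derivable_test2 p z : test_function p -> derivable p z e2.
Proof. by move=> /test_smooth sp; case: (smooth_is_derive2 p z sp). Qed.

Lemma functional0 f : functional1 f (fun=> 0) = 0 /\
  functional2 f (fun=> 0) = 0.
Proof.
have i0 : inner mu2 f (fun=> 0) = 0.
  by rewrite /inner; under eq_Rintegral do rewrite mulr0;
    rewrite /Rintegral integral0.
have n0 : nrm2 mu2 (fun=> 0) = 0.
  by rewrite /nrm2 /inner; under eq_Rintegral do rewrite mulr0;
    rewrite /Rintegral integral0.
have d0 v : (fun z : R * R => 'D_v (fun=> 0 : R) z) = (fun=> 0).
  by apply/funext => z; rewrite derive_cst.
by rewrite /functional1 /functional2 !d0 i0 n0 mulr0 subr0.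
Qed.

(** If the test functionals stay bounded, the Riesz representation produces the
    weak gradient. *)
Lemma H1_of_functional_bound f (M : R) : sqint mu2 f ->
  (forall p1 p2, test_function p1 -> test_function p2 ->
     functional1 f p1 + functional2 f p2 <= M) -> H1 f.
Proof.
move=> sf hM; have [f1 f2] := functional0 f.
have [p tp|g1 s1 w1] := weak_partial_riesz e1 f M sf test_d1
  derivable_test1.
  by have := hM p _ tp test0; rewrite f2 addr0.
have [p tp|g2 s2 w2] := weak_partial_riesz e2 f M sf test_d2
  derivable_test2.
  by have := hM _ p test0 tp; rewrite f1 add0r.
split; first exact/L2P.
by exists (g1, g2); split => //; exact/L2P.
Qed.

Lemma functional1_weak f g p : is_weak_partial e1 f g -> test_function p ->
  functional1 f p = 2 * inner mu2 g p - nrm2 mu2 p.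
Proof.
move=> w tp; rewrite /functional1.
have -> : inner mu2 f (fun z => 'D_e1 p z) = - inner mu2 g p by exact: w.
by rewrite mulrN mulNr opprK.
Qed.

Lemma functional2_weak f g p : is_weak_partial e2 f g -> test_function p ->
  functional2 f p = 2 * inner mu2 g p - nrm2 mu2 p.
Proof.
move=> w tp; rewrite /functional2.
have -> : inner mu2 f (fun z => 'D_e2 p z) = - inner mu2 g p by exact: w.
by rewrite mulrN mulNr opprK.
Qed.

(** By density, the supremum that defines the norm by duality is approached by
    test functions. *)
Lemma nrm2_approx g (e : R) : sqint mu2 g -> 0 < e ->
  exists2 p, test_function p & nrm2 mu2 g - e < 2 * inner mu2 g p - nrm2 mu2 p.
Proof.
move=> sg e0; apply: contrapT => h.
have : nrm2 mu2 g <= nrm2 mu2 g - e.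
  apply: nrm2_le_test => // p tp; rewrite leNgt; apply/negP => hp.
  by apply: h; exists p.
lra.
Qed.

Lemma dirichletE f : H1 f ->
  dirichlet f = (nrm2 mu2 (weak_gradient f).1 +
    nrm2 mu2 (weak_gradient f).2)%:E.
Proof.
move=> Hf; have [_ exg] := Hf.
have [/L2P s1 /L2P s2 _ _] := xgetPex (cst 0, cst 0) exg.
rewrite /dirichlet asboolT// EFinD (nrm2E _ s1) (nrm2E _ s2) -ge0_integralD//.
- by move=> z _; rewrite lee_fin sqr_ge0.
- by apply/measurable_EFinP; apply: measurable_funX; case: s1.
- by move=> z _; rewrite lee_fin sqr_ge0.
- by apply/measurable_EFinP; apply: measurable_funX; case: s2.
Qed.

End WeakGradient.

Section Limit.
Context {R : realType}.
Local Notation mu2 := (lebesgue2 R).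
Implicit Types (f : R * R -> R).

Let c_gt0 : 0 < 1 / (4 * pi) :> R.
Proof. by rewrite divr_gt0// mulr_gt0// pi_gt0. Qed.

Let approx_arith (a b x y e : R) : a - e / 3 < x -> b - e / 3 < y ->
  a + b - e <= x + y - e / 3.
Proof. lra. Qed.

Lemma ginibre_variance_ge0 f L : (0 <= ginibre_variance L f)%E.
Proof.
apply: mule_ge0; first by rewrite lee_fin invr_ge0.
apply: integral_ge0 => x _; apply: integral_ge0 => y _.
by rewrite lee_fin mulr_ge0 ?sqr_ge0.
Qed.

Lemma ginibre_variance_cvg_H1 f : sqint mu2 f -> H1 f ->
  (ginibre_variance L f @[L --> +oo%R] -->
     ((1 / (4 * pi))%:E * dirichlet f)%E).
Proof.
move=> sf Hf; rewrite dirichletE//; have [_ exg] := Hf.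
have [/L2P s1 /L2P s2 w1 w2] := xgetPex (cst 0, cst 0) exg.
rewrite -/(weak_gradient f) in s1 s2 w1 w2.
move: (weak_gradient f).1 (weak_gradient f).2 s1 s2 w1 w2 => g1 g2 s1 s2 w1 w2.
set V := nrm2 mu2 g1 + nrm2 mu2 g2.
have cp : 0 < 1 / (4 * pi) :> R := c_gt0.
set c : R := 1 / (4 * pi) in cp *.
have up L : 0 < L -> (ginibre_variance L f <= (c * V)%:E)%E.
  by move=> L0; exact: ginibre_variance_le.
have low (e : R) : 0 < e -> exists2 L0 : R, 0 < L0 &
    forall L, L0 <= L -> ((c * (V - e))%:E <= ginibre_variance L f)%E.
  move=> e0; have e30 : 0 < e / 3 by rewrite divr_gt0.
  have [p1 t1 h1] := nrm2_approx g1 _ s1 e30.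
  have [p2 t2 h2] := nrm2_approx g2 _ s2 e30.
  have [L0 L00 hL] := ginibre_variance_ge f p1 p2 _ sf t1 t2 e30.
  exists L0 => // L /hL; apply: le_trans.
  rewrite lee_fin ler_pM2l//.
  rewrite (functional1_weak _ _ _ w1 t1) (functional2_weak _ _ _ w2 t2).
  exact: approx_arith h1 h2.
have fin L : 0 < L -> ginibre_variance L f \is a fin_num.
  move=> L0; rewrite ge0_fin_numE ?ginibre_variance_ge0//.
  by apply: le_lt_trans (up L L0) _; exact: ltry.
rewrite -EFinM; apply: cvg_EFin.
  by near=> L; apply: fin; near: L; exact: nbhs_pinfty_gt.
apply/cvgrPdist_le => e e0.
have ec0 : 0 < e / c by rewrite divr_gt0.
have [L0 L00 hL] := low _ ec0.
near=> L; have L0L : L0 <= L by near: L; apply: nbhs_pinfty_ge; exact: num_real.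
have Lp : 0 < L by exact: lt_le_trans L0L.
have := hL L L0L; have := up L Lp.
rewrite -(fineK (fin L Lp)) !lee_fin mulrBr [c * (e / c)]mulrC divfK ?gt_eqF//=.
move: (fine _) (c * V) => x y; rewrite ler_norml; lra.
Unshelve. all: end_near. Qed.

Lemma ginibre_variance_cvg_pinfty f : sqint mu2 f -> ~ H1 f ->
  ginibre_variance L f @[L --> +oo%R] --> +oo%E.
Proof.
move=> sf nH; apply/cvgeyPge => A.
have cp : 0 < 1 / (4 * pi) :> R := c_gt0.
set c : R := 1 / (4 * pi) in cp *.
have [p1 [p2 [t1 t2 hp]]] : exists p1 p2 : R * R -> R,
    [/\ test_function p1, test_function p2 &
     A / c + 1 < functional1 f p1 + functional2 f p2].
  apply: contrapT => h; apply: nH;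
    apply: (H1_of_functional_bound _ (A / c + 1) sf).
  move=> p1 p2 t1 t2; rewrite leNgt; apply/negP => hp.
  by apply: h; exists p1, p2.
have [L0 L00 hL] := ginibre_variance_ge f p1 p2 1 sf t1 t2 ltr01.
near=> L; have L0L : L0 <= L by near: L; apply: nbhs_pinfty_ge; exact: num_real.
apply: le_trans (hL L L0L); rewrite lee_fin.
by rewrite -/c mulrC -ler_pdivrMr// lerBrDr ltW.
Unshelve. all: end_near. Qed.

End Limit.

Theorem theorem2p7 (R : realType) (f : R * R -> R) (hf : L2 f) :
  (ginibre_variance L f @[L --> +oo%R] -->
     ((1 / (4 * pi))%:E * dirichlet f)%E) /\
  (lim (ginibre_variance L f @[L --> +oo%R]) \is a fin_num <-> H1 f).
Proof.
have sf := (L2P f).1 hf.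
have [Hf|nHf] := pselect (H1 f).
  have cf := ginibre_variance_cvg_H1 f sf Hf; split => //; split => // _.
  by rewrite (cvg_lim _ cf)// dirichletE// -EFinM.
have cy := ginibre_variance_cvg_pinfty f sf nHf.
split; last by rewrite (cvg_lim _ cy).
rewrite /dirichlet asboolF// gt0_muley// lte_fin.
by rewrite divr_gt0// mulr_gt0// pi_gt0.
Qed.
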